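(* Let $\alpha>-1$ and let $\phi(w)=aw+b$ with $a\in(0,1)$ and $\operatorname{Re}(b)\ge 0$ (that is, $\phi$ is hyperbolic of type I). Then the composition operator $C_\phi$ is not cyclic on $\mathcal{A}^2_\alpha(\mathbb{C}_+)$.
   Context: $\mathbb{C}_+=\{z\in\mathbb{C}:\operatorname{Re}(z)>0\}$ is the open right half-plane. For $\alpha>-1$, the weighted Bergman space $\mathcal{A}^2_\alpha(\mathbb{C}_+)$ is the Hilbert space of all holomorphic functions $f$ on $\mathbb{C}_+$ with finite norm $\|f\|=\left(\int_{\mathbb{C}_+}|f(x+iy)|^2x^\alpha\,dx\,dy\right)^{1/2}$. For $\phi(w)=aw+b$ with $a>0$ and $\operatorname{Re}(b)\ge 0$, the composition operator $C_\phi f=f\circ\phi$ is a bounded operator on $\mathcal{A}^2_\alpha(\mathbb{C}_+)$. A bounded linear operator $T$ on a separable Banach space $\mathcal{X}$ is cyclic if there is a non-zero $f\in\mathcal{X}$ such that $\operatorname{span}\{T^nf:n\in\mathbb{N}\}$ is dense in $\mathcal{X}$, where $\mathbb{N}$ is the set of non-negative integers. *)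

(* Defs.v *)
From HB Require Import structures.
From mathcomp Require Import all_boot all_order all_algebra.
From mathcomp Require Import all_classical all_reals all_analysis.
From mathcomp Require Import measurable_realfun complex.
From mathcomp Require Import ring lra.

Set Implicit Arguments.
Unset Strict Implicit.
Unset Printing Implicit Defensive.

Import Order.TTheory GRing.Theory Num.Theory.
Import numFieldNormedType.Exports.
Import Normc.

Local Open Scope classical_set_scope.
Local Open Scope ring_scope.
Local Open Scope complex_scope.

Section cyclicity.
Variables (K : numFieldType) (X : normedModType K).

Definition lin_span (S : set X) : set X :=
  [set v | exists2 s : seq X, (forall u, u \in s -> S u) &
           exists c : X -> K, v = \sum_(u <- s) c u *: u].

Definition cyclic (T : X -> X) : Prop :=
  exists f : X, f != 0 /\ dense (lin_span [set iter n T f | n in [set: nat]]).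

End cyclicity.

(* The increments in the difference quotients range over K, so for K = R[i]
   this is complex differentiability at every point of D. *)
Definition holomorphic_on (K : numFieldType) (D : set K) (f : K -> K) : Prop :=
  forall z, D z -> derivable f z 1.

Lemma holomorphic_onD (K : numFieldType) (D : set K) (f g : K -> K) :
  holomorphic_on D f -> holomorphic_on D g ->
  holomorphic_on D (fun z => f z + g z).
Proof. by move=> hf hg z Hz; apply: derivableD; [exact: hf|exact: hg]. Qed.

Lemma holomorphic_onZ (K : numFieldType) (D : set K) (k : K) (f : K -> K) :
  holomorphic_on D f -> holomorphic_on D (fun z => k * f z).
Proof. by move=> hf z Hz; apply: derivableZ; exact: hf. Qed.

Definition right_half_plane (R : realType) : set R[i] :=
  [set z | 0 < complex.Re z].

Definition bergman_sqnorm (R : realType) (alpha : R) (f : R[i] -> R[i]) : \bar R :=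
  (\int[lebesgue_measure \x lebesgue_measure]_(p in
      [set p : R * R | right_half_plane (p.1 +i* p.2)])
     (normc (f (p.1 +i* p.2)) ^+ 2 * p.1 `^ alpha)%:E)%E.

Definition bergman_norm (R : realType) (alpha : R) (f : R[i] -> R[i]) : R :=
  Num.sqrt (fine (bergman_sqnorm alpha f)).

(* A function on the half-plane is represented by its extension by 0 to R[i],
   so that equality of representatives is equality on the half-plane. *)
Definition bergman_pred (R : realType) (alpha : R) : {pred R[i] -> R[i]} :=
  [pred f : R[i] -> R[i] | `[< [/\ holomorphic_on (@right_half_plane R) f,
     forall z, ~ right_half_plane z -> f z = 0 &
     (bergman_sqnorm alpha f < +oo)%E] >]].

Section open_prod.
Variable R : realType.

Lemma measurable_open_prod (U : set (R * R)) :
  (forall p, U p -> exists2 d : R, 0 < d &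
     forall q, `|q.1 - p.1| < d -> `|q.2 - p.2| < d -> U q) ->
  measurable U.
Proof.
move=> oU.
pose B (q1 q2 : rat) (n : nat) : set (R * R) :=
  ball (ratr q1 : R) n.+1%:R^-1 `*` ball (ratr q2 : R) n.+1%:R^-1.
pose F q1 q2 n := if `[< B q1 q2 n `<=` U >] then B q1 q2 n else set0.
have -> : U = \bigcup_q1 \bigcup_q2 \bigcup_n F q1 q2 n.
  apply/seteqP; split=> [p Up|p [q1 _ [q2 _ [n _]]]]; last first.
    by rewrite /F; case: asboolP => // BU /BU.
  have [d d0 dU] := oU _ Up.
  have [n nd] : exists n, n.+1%:R^-1 < d / 2 :> R.
    have /ltr_add_invr[k] : 0 < d / 2 by rewrite divr_gt0.
    by rewrite add0r => kd; exists k.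
  pose e : R := n.+1%:R^-1; have e0 : 0 < e by rewrite invr_gt0.
  have {}nd : e < d / 2 by [].
  have [q1 q1p] := @rat_in_itvoo R p.1 (p.1 + e) ltac:(by rewrite ltrDl).
  have [q2 q2p] := @rat_in_itvoo R p.2 (p.2 + e) ltac:(by rewrite ltrDl).
  rewrite !in_itv/= in q1p q2p.
  exists q1 => //; exists q2 => //; exists n => //; rewrite /F.
  case: asboolP => [_|].
    by split; rewrite /ball/= ltr_norml -/e; apply/andP; split; lra.
  case=> -[u v]; rewrite /B /ball/= -/e !ltr_norml => -[/andP[? ?] /andP[? ?]].
  by apply: dU => /=; rewrite ltr_norml; apply/andP; split; lra.
apply: bigcupT_measurable_rat => q1; apply: bigcupT_measurable_rat => q2.
apply: bigcupT_measurable => n; rewrite /F; case: ifP => // _.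
by apply: measurableX; rewrite ball_itv; exact: measurable_itv.
Qed.

End open_prod.

Section bergman_theory.
Variables (R : realType) (alpha : R).
Local Notation C := R[i].
Local Notation H := (@right_half_plane R).
Local Notation mu := (@lebesgue_measure R \x @lebesgue_measure R)%E.


Let le_normc (x y : R) : normc (x +i* y) <= `|x| + `|y|.
Proof.
rewrite -[leRHS]ger0_norm ?addr_ge0// -sqrtr_sqr ler_wsqrtr//.
rewrite -(real_normK (num_real x)) -(real_normK (num_real y)).
by have := normr_ge0 x; have := normr_ge0 y; nra.
Qed.

Let ler_normcD (u v : C) : normc (u + v) <= normc u + normc v.
Proof. exact: (@le_normcD R). Qed.

Let normc_ge0 (u : C) : 0 <= normc u.
Proof. by case: u => x y; exact: sqrtr_ge0. Qed.

Lemma holomorphic_near (f : C -> C) (p : R * R) (e : R) :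
  holomorphic_on H f -> H (p.1 +i* p.2) -> 0 < e ->
  exists2 d : R, 0 < d & forall q : R * R,
    `|q.1 - p.1| < d -> `|q.2 - p.2| < d ->
    H (q.1 +i* q.2) /\ normc (f (p.1 +i* p.2) - f (q.1 +i* q.2)) < e.
Proof.
move=> hf Hp e0.
have /derivable1_diffP/differentiable_continuous cf := hf _ Hp.
have e0C : 0 < e%:C by rewrite ltcR.
move/cvgrPdist_lt : cf => /(_ _ e0C).
move=> /nbhs_ballP[[d d'] /= d0 dP].
move: d0; rewrite ltcE/= => /andP[/eqP d'0 d0].
rewrite d'0 in dP.
exists (Num.min p.1 (d / 2)); first by rewrite lt_min Hp divr_gt0.
move=> q; rewrite !lt_min => /andP[q1 q1d] /andP[q2 q2d]; split.
  by move: q1; rewrite /right_half_plane/= ltr_norml; lra.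
rewrite -ltcR; apply: (dP (q.1 +i* q.2)).
rewrite /ball/= ltcR.
rewrite -[_ - _]/((p.1 - q.1) +i* (p.2 - q.2)).
rewrite (le_lt_trans (le_normc _ _))//.
by rewrite (distrC p.1) (distrC p.2) (splitr d) ltrD.
Qed.

Let absf (f : C -> C) (p : R * R) : R :=
  if 0 < p.1 then normc (f (p.1 +i* p.2)) else 0.

Let measurable_absf (f : C -> C) : holomorphic_on H f ->
  measurable_fun setT (absf f).
Proof.
move=> hf; apply: (measurability _ (RGenOInfty.measurableE R)) => //.
move=> _ [_ [c ->] <-]; rewrite setTI.
have [c0|c0] := ltP c 0.
  rewrite (_ : _ @^-1` _ = setT)//; apply/seteqP; split=> // p _ /=.
  by rewrite in_itv/= andbT /absf; case: ifP => _ //; exact: lt_le_trans c0 _.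
apply: measurable_open_prod => p /=; rewrite in_itv/= andbT /absf.
case: ifPn => [p0 cp|_]; last by rewrite ltNge c0.
have [d d0 dP] := @holomorphic_near f p (normc (f (p.1 +i* p.2)) - c) hf p0
  ltac:(by rewrite subr_gt0).
exists d => // q q1 q2; have [Hq] := dP q q1 q2.
rewrite in_itv/= andbT ifT//.
have := ler_normcD (f (p.1 +i* p.2) - f (q.1 +i* q.2)) (f (q.1 +i* q.2)).
by rewrite subrK; lra.
Qed.

Let wf (f : C -> C) (p : R * R) : R := absf f p * p.1 `^ (alpha / 2).

Let measurable_wf (f : C -> C) : holomorphic_on H f ->
  measurable_fun setT (wf f).
Proof.
move=> hf; apply: measurable_funM; first exact: measurable_absf.
by apply: (measurableT_comp (measurable_powR _)).
Qed.

Let wf_ge0 f p : 0 <= wf f p.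
Proof. by rewrite mulr_ge0 ?powR_ge0// /absf; case: ifP. Qed.

Let sqnormE f : bergman_sqnorm alpha f = (\int[mu]_p (wf f p ^+ 2)%:E)%E.
Proof.
rewrite /bergman_sqnorm integral_mkcond; apply: eq_integral => p _.
rewrite patchE /wf /absf; case: ifPn => [/set_mem|/negP pH]; last first.
  case: ifP => [p0|_]; first by exfalso; apply: pH; apply/mem_set.
  by rewrite mul0r expr0n.
rewrite /right_half_plane/= => p0; rewrite p0 exprMn; congr (_ * _)%:E.
by rewrite -powR_mulrn ?powR_ge0// -powRrM divfK.
Qed.

Let Nwf f := ('N[mu]_2%:E[EFin \o wf f])%E.

Let sqnorm_Nwf f : bergman_sqnorm alpha f = (Nwf f `^ 2)%E.
Proof.
rewrite sqnormE /Nwf poweR_Lnorm//; apply: eq_integral => p _ /=.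
rewrite ger0_norm//.
by rewrite powR_mulrn.
Qed.

Let Nwf_ge0 f : (0 <= Nwf f)%E. Proof. exact: Lnorm_ge0. Qed.

Let sqnorm_ge0 f : (0 <= bergman_sqnorm alpha f)%E.
Proof. by rewrite sqnorm_Nwf poweR_ge0. Qed.

Let Nwf_fin f : (bergman_sqnorm alpha f < +oo)%E -> Nwf f \is a fin_num.
Proof.
rewrite sqnorm_Nwf; have := Nwf_ge0 f.
by case: (Nwf f) => // _ ; rewrite poweRyr.
Qed.

Let bergman_normE f : (bergman_sqnorm alpha f < +oo)%E ->
  (bergman_norm alpha f)%:E = Nwf f.
Proof.
move=> /[dup] /Nwf_fin Nfin _; rewrite /bergman_norm sqnorm_Nwf.
rewrite -(fineK Nfin) poweR_EFin/= powR_mulrn ?fine_ge0//.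
by rewrite sqrtr_sqr ger0_norm ?fine_ge0.
Qed.

Let NwfD (f g : C -> C) : holomorphic_on H f -> holomorphic_on H g ->
  (Nwf (fun z => f z + g z)%R <= Nwf f + Nwf g)%E.
Proof.
move=> hf hg.
have := @minkowski_EFin _ _ R mu (wf f) (wf g) 2 (measurable_wf hf)
  (measurable_wf hg) ltac:(by rewrite ler1n).
apply: le_trans; rewrite /Nwf unlock /Lnorm.
have mp (u : R * R -> R) : measurable_fun setT u ->
    measurable_fun setT (fun p => (`|u p| `^ 2)%:E).
  move=> mu'; apply/measurable_EFinP.
  by apply: (measurableT_comp (measurable_powR _)); exact: measurableT_comp.
apply: gt0_ler_poweR; rewrite ?invr_ge0// ?in_itv/= ?leey ?andbT.
- by apply: integral_ge0 => p _; rewrite lee_fin powR_ge0.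
- by apply: integral_ge0 => p _; rewrite lee_fin powR_ge0.
apply: ge0_le_integral => //=.
- exact: (mp _ (measurable_wf (holomorphic_onD hf hg))).
- exact: (mp _ (measurable_funD (measurable_wf hf) (measurable_wf hg))).
move=> p _; rewrite lee_fin ge0_ler_powR ?nnegrE//.
rewrite !ger0_norm ?addr_ge0// -mulrDl ler_wpM2r ?powR_ge0//.
by rewrite /absf; case: ifP => _; rewrite ?addr0//; exact: ler_normcD.
Qed.

Let sqnormZ (k : C) (f : C -> C) : holomorphic_on H f ->
  bergman_sqnorm alpha (fun z => k * f z)%R = ((normc k ^+ 2)%:E * bergman_sqnorm alpha f)%E.
Proof.
move=> hf; rewrite !sqnormE -ge0_integralZl_EFin//.
- apply: eq_integral => p _; rewrite -EFinM -exprMn; congr (_ ^+ 2)%:E.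
  rewrite /wf mulrA; congr (_ * _); rewrite /absf.
  by case: ifP => _; rewrite ?mulr0// -normcM.
- by move=> p _; rewrite lee_fin sqr_ge0.
- by apply/measurable_EFinP; apply: measurable_funX; exact: measurable_wf.
- exact: sqr_ge0.
Qed.

Let sqnorm0 : bergman_sqnorm alpha 0 = 0%E.
Proof.
rewrite sqnormE integral0_eq// => p _.
by rewrite /wf /absf normc0 if_same mul0r expr0n.
Qed.

Lemma bergmanP (f : C -> C) :
  reflect [/\ holomorphic_on H f, forall z, ~ H z -> f z = 0 &
             (bergman_sqnorm alpha f < +oo)%E]
          (f \in @bergman_pred R alpha).
Proof. exact: asboolP. Qed.

Let bergman_predD (f g : C -> C) :
  f \in bergman_pred alpha -> g \in bergman_pred alpha ->
  (fun z => f z + g z) \in bergman_pred alpha.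
Proof.
move=> /bergmanP[hf f0 foo] /bergmanP[hg g0 goo]; apply/bergmanP; split.
- exact: holomorphic_onD.
- by move=> z Hz; rewrite f0// g0// addr0.
- rewrite sqnorm_Nwf poweR_lty// (le_lt_trans (NwfD hf hg))//.
  by rewrite lte_add_pinfty// -ge0_fin_numE// Nwf_fin.
Qed.

Let bergman_predZ (k : C) (f : C -> C) :
  f \in bergman_pred alpha -> (fun z => k * f z) \in bergman_pred alpha.
Proof.
move=> /bergmanP[hf f0 foo]; apply/bergmanP; split.
- exact: holomorphic_onZ.
- by move=> z Hz; rewrite f0// mulr0.
- by rewrite sqnormZ// lte_mul_pinfty// lee_fin sqr_ge0.
Qed.

Lemma bergman_submod_closed : submod_closed (@bergman_pred R alpha).
Proof.
split=> [|k f g fA gA].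
  by apply/bergmanP; split=> //; rewrite sqnorm0.
exact: (bergman_predD (bergman_predZ k fA) gA).
Qed.

Let bergman_normD (f g : C -> C) : f \in bergman_pred alpha -> g \in bergman_pred alpha ->
  bergman_norm alpha (fun z => f z + g z) <= bergman_norm alpha f + bergman_norm alpha g.
Proof.
move=> fA gA.
have fgA := bergman_predD fA gA.
move: fA gA fgA => /bergmanP[hf _ fo] /bergmanP[hg _ go].
by move=> /bergmanP[_ _ fgo]; rewrite -lee_fin EFinD !bergman_normE// NwfD.
Qed.

Let bergman_normZ (k : C) (f : C -> C) : f \in bergman_pred alpha ->
  bergman_norm alpha (fun z => k * f z) = normc k * bergman_norm alpha f.
Proof.
move=> /bergmanP[hf _ fo]; rewrite /bergman_norm sqnormZ// fineM//.
  by rewrite sqrtrM ?sqr_ge0// sqrtr_sqr ger0_norm.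
by rewrite ge0_fin_numE.
Qed.

Let bergman_norm_eq0 (f : C -> C) : f \in bergman_pred alpha -> bergman_norm alpha f = 0 -> f = 0.
Proof.
move=> /bergmanP[hf f0 fo] nf0; apply/funext => z.
have [Hz|] := pselect (H z); last exact: f0.
apply: contrapT => fz.
have [p zp] : exists p : R * R, z = p.1 +i* p.2.
  by case: (z) => x y; exists (x, y).
rewrite {z}zp in Hz fz.
have fp_gt0 : 0 < normc (f (p.1 +i* p.2)).
  by rewrite lt_def normc_ge0 andbT; apply/eqP => /eq0_normc.
have [d d0 dP] := holomorphic_near hf Hz fp_gt0.
have Nf0 : Nwf f = 0%E by rewrite -bergman_normE// nf0.
have mf : measurable_fun setT (EFin \o wf f).
  by apply/measurable_EFinP; exact: measurable_wf.
have p2 : (0 < 2%:E :> \bar R)%E by rewrite lte_fin.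
have [A [mA A0 wA]] := @Lnorm_eq0_eq0 _ _ _ mu _ _ mf p2 Nf0.
suff : (0 < mu A)%E by rewrite A0 ltxx.
have BA : ball p.1 d `*` ball p.2 d `<=` A.
  move=> q [q1 q2]; apply: wA => /= /(_ I) [] /eqP; apply/negP.
  have [Hq fq] := dP q ltac:(by rewrite distrC) ltac:(by rewrite distrC).
  rewrite /wf /absf ifT// mulf_neq0//.
    apply/eqP => fq0; move: fq.
    have := ler_normcD (f (p.1 +i* p.2) - f (q.1 +i* q.2)) (f (q.1 +i* q.2)).
    by rewrite subrK fq0; lra.
  by rewrite gt_eqF// powR_gt0.
have mb (x : R) : measurable (ball x d) by rewrite ball_itv; exact: measurable_itv.
have mB : measurable (ball p.1 d `*` ball p.2 d) by exact: measurableX.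
apply: (@lt_le_trans _ _ (mu (ball p.1 d `*` ball p.2 d))); last first.
  by apply: le_measure; rewrite ?inE.
rewrite product_measure1E; [|exact: mb|exact: mb].
have lb (x : R) : (0 < lebesgue_measure (ball x d))%E.
  by rewrite lebesgue_measure_ball ?ltW// lte_fin mulrn_wgt0.
by apply: mule_gt0; exact: lb.
Qed.

Lemma bergman_norm_axioms : [/\
  forall f g : C -> C, f \in bergman_pred alpha -> g \in bergman_pred alpha ->
    bergman_norm alpha (fun z => f z + g z) <= bergman_norm alpha f + bergman_norm alpha g,
  forall (k : C) (f : C -> C), f \in bergman_pred alpha ->
    bergman_norm alpha (fun z => k * f z) = normc k * bergman_norm alpha f &
  forall f : C -> C, f \in bergman_pred alpha -> bergman_norm alpha f = 0 -> f = 0].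
Proof.
by split; [exact: bergman_normD|exact: bergman_normZ|exact: bergman_norm_eq0].
Qed.

End bergman_theory.

HB.instance Definition _ (R : realType) (alpha : R) :=
  GRing.isSubmodClosed.Build _ _ (@bergman_pred R alpha)
    (bergman_submod_closed alpha).

Record bergman (R : realType) (alpha : R) := Bergman {
  bergman_fun :> R[i] -> R[i] ;
  bergman_funP : bergman_fun \in @bergman_pred R alpha }.

Section bergman_space.
Variables (R : realType) (alpha : R).

HB.instance Definition _ := [isSub for @bergman_fun R alpha].
HB.instance Definition _ := [Choice of bergman alpha by <:].
HB.instance Definition _ := [SubChoice_isSubLmodule of bergman alpha by <:].

Definition bergman_cnorm (f : bergman alpha) : R[i] := (bergman_norm alpha f)%:C.

Let cnormD (f g : bergman alpha) :
  bergman_cnorm (f + g) <= bergman_cnorm f + bergman_cnorm g.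
Proof.
rewrite /bergman_cnorm -rmorphD lecR.
by have [+ _ _] := bergman_norm_axioms alpha; apply; exact: bergman_funP.
Qed.

Let cnormZ (k : R[i]) (f : bergman alpha) :
  bergman_cnorm (k *: f) = `|k| * bergman_cnorm f.
Proof.
rewrite /bergman_cnorm -[`|k|]/((normc k)%:C) -rmorphM; congr (_%:C).
by have [_ + _] := bergman_norm_axioms alpha; apply; exact: bergman_funP.
Qed.

Let cnorm_eq0 (f : bergman alpha) : bergman_cnorm f = 0 -> f = 0.
Proof.
move=> [nf0]; apply: val_inj => /=.
by have [_ _ +] := bergman_norm_axioms alpha; apply => //; exact: bergman_funP.
Qed.

HB.instance Definition _ :=
  Lmodule_isNormed.Build R[i] (bergman alpha) cnormD cnormZ cnorm_eq0.

(* f \o phi on the half-plane, extended by 0.  For phi w = a * w + b with a > 0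
   and Re b >= 0 this function belongs to the space again whenever alpha > -1,
   so the default value 0 of insubd is then never taken; it is there because
   that boundedness theorem is not part of this file. *)
Definition composition (phi : R[i] -> R[i]) (f : bergman alpha) : bergman alpha :=
  insubd 0 (fun z => if 0 < complex.Re z then f (phi z) else 0).

Lemma bergman_normrE (f : bergman alpha) :
  `|f| = (Num.sqrt (fine (bergman_sqnorm alpha f)))%:C.
Proof. by []. Qed.

Lemma compositionE (phi : R[i] -> R[i]) (f : bergman alpha) (z : R[i]) :
  (fun z => if 0 < complex.Re z then f (phi z) else 0) \in bergman_pred alpha ->
  right_half_plane z -> composition phi f z = f (phi z).
Proof.
move=> fphi Hz; rewrite -[LHS]/(val (composition phi f) z) /composition.
by rewrite insubdK//= ifT.
Qed.

End bergman_space.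

(* Main.v *)
Require Import Defs.
From HB Require Import structures.
From mathcomp Require Import all_boot all_order all_algebra.
From mathcomp Require Import all_classical all_reals all_analysis.
From mathcomp Require Import complex.
From mathcomp Require Import measurable_realfun ring lra zify.

(* Let w0 = s + i e be the fixed point of phi, so that 0 <= s and phi maps
   w0 + x to w0 + a x; suppose that f is cyclic.  For p, p' > 0 consider
     L(g) = sum_(n in Z) g(w0 + a^n p) f(w0 + a^-n p')
                       - g(w0 + a^n p') f(w0 + a^-n p).
   Replacing g by f o phi^k and n by -n-k turns the first sum into the second,
   so L kills the orbit of f.  L is bounded: for s = 0 because the numbers
   (a^n p)^(1 + alpha/2) f(w0 + a^n p) are square summable over Z (disjoint
   squares around the points), for s > 0 because point evaluation at z has norm
   O((Re z)^-(1 + alpha/2)) and the products decay geometrically.  Hence L = 0.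
   Testing L on f h^m, where h is bounded on the half-plane, h(w0 + p) = 1 and
   |h| <= q < 1 at all the other points involved, gives f(w0 + p) f(w0 + p') = 0
   whenever a p < p' < p, so f vanishes on the ray w0 + (0, +oo).  The same then
   holds for its whole orbit, hence for every element of the space, which is
   absurd because the affine automorphisms of the half-plane act on the space.

   The point estimates come from a Cauchy formula over squares, proved by
   Goursat's bisection argument: in the coordinates w + i^k u (1 + i t), u > 0,
   -1 <= t <= 1, the form F dz / (z - w) becomes F (du / u + i dt / (1 + i t)). *)

Set Implicit Arguments.
Unset Strict Implicit.
Unset Printing Implicit Defensive.
Import Order.TTheory GRing.Theory Num.Theory.
Import numFieldNormedType.Exports Normc.
Local Open Scope classical_set_scope.
Local Open Scope ring_scope.
Local Open Scope complex_scope.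

(** * Goursat bisection *)

(** Goursat's argument: halving both sides divides the squared half-perimeter by 4, so a rectangle
    that violates the local bound has a quarter that violates it too. The nested quarters shrink to
    a point [(p, q)], where the local bound gives a contradiction. *)
Lemma additive_rectangle_eq0 (R : realType) (I : R -> R -> R -> R -> R)
    (x1 x2 y1 y2 : R) : x1 <= x2 -> y1 <= y2 ->
  (forall a m b c d, x1 <= a -> a <= m -> m <= b -> b <= x2 ->
     y1 <= c -> c <= d -> d <= y2 -> I a b c d = I a m c d + I m b c d) ->
  (forall a b c m d, x1 <= a -> a <= b -> b <= x2 ->
     y1 <= c -> c <= m -> m <= d -> d <= y2 -> I a b c d = I a b c m + I a b m d) ->
  (forall p q, x1 <= p <= x2 -> y1 <= q <= y2 -> forall e, 0 < e ->
     exists2 r, 0 < r & forall a b c d, x1 <= a <= p -> p <= b <= x2 ->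
       y1 <= c <= q -> q <= d <= y2 -> b - a < r -> d - c < r ->
       `|I a b c d| <= e * (b - a + (d - c)) ^+ 2) ->
  I x1 x2 y1 y2 = 0.
Proof.
move=> x12 y12 addx addy loc; have [//|I0] := eqVneq (I x1 x2 y1 y2) 0.
exfalso; move: I0; rewrite -normr_gt0 => I0.
pose S := x2 - x1 + (y2 - y1).
(* With this [e] the whole rectangle violates the bound; the [+ 1] covers a degenerate rectangle,
   where [S = 0]. *)
pose e := `|I x1 x2 y1 y2| / (2 * (S ^+ 2 + 1)).
have D0 : 0 < 2 * (S ^+ 2 + 1) by have := sqr_ge0 S; lra.
have e0 : 0 < e by rewrite divr_gt0.
pose ok (Q : (R * R) * (R * R)) := [/\ x1 <= Q.1.1, Q.1.1 <= Q.1.2 & Q.1.2 <= x2] /\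
  [/\ y1 <= Q.2.1, Q.2.1 <= Q.2.2 & Q.2.2 <= y2] /\
  e * (Q.1.2 - Q.1.1 + (Q.2.2 - Q.2.1)) ^+ 2 < `|I Q.1.1 Q.1.2 Q.2.1 Q.2.2|.
pose T := {Q | ok Q}.
have step (Q : T) : exists Q' : T,
    [/\ (sval Q).1.1 <= (sval Q').1.1, (sval Q').1.2 <= (sval Q).1.2 &
        (sval Q').1.2 - (sval Q').1.1 = ((sval Q).1.2 - (sval Q).1.1) / 2] /\
    [/\ (sval Q).2.1 <= (sval Q').2.1, (sval Q').2.2 <= (sval Q).2.2 &
        (sval Q').2.2 - (sval Q').2.1 = ((sval Q).2.2 - (sval Q).2.1) / 2].
  case: Q => [[[a b] [c d]]] /= [[/= xa ab bx] [[yc cd dy] bad]].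
  pose m := (a + b) / 2; pose k := (c + d) / 2.
  have am : a <= m by rewrite /m; lra.
  have mb : m <= b by rewrite /m; lra.
  have ck : c <= k by rewrite /k; lra.
  have kd : k <= d by rewrite /k; lra.
  have E : I a b c d = I a m c k + I a m k d + (I m b c k + I m b k d).
    rewrite (addx a m b c d)// (addy a m c k d)//; last lra.
    by rewrite (addy m b c k d)//; lra.
  have H : `|I a b c d| <= `|I a m c k| + `|I a m k d| + (`|I m b c k| + `|I m b k d|).
    by rewrite E (le_trans (ler_normD _ _))// lerD// ler_normD.
  (* The bound for a quarter, one fourth of the bound for its parent. *)
  pose s := e * ((b - a) / 2 + (d - c) / 2) ^+ 2.
  have sE : e * (b - a + (d - c)) ^+ 2 = 4 * s by rewrite /s; field.
  have fin a' b' c' d' : a <= a' -> a' <= b' -> b' <= b -> c <= c' -> c' <= d' -> d' <= d ->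
      b' - a' = (b - a) / 2 -> d' - c' = (d - c) / 2 -> s < `|I a' b' c' d'| ->
      exists Q' : T, [/\ a <= (sval Q').1.1, (sval Q').1.2 <= b &
        (sval Q').1.2 - (sval Q').1.1 = (b - a) / 2] /\
      [/\ c <= (sval Q').2.1, (sval Q').2.2 <= d &
        (sval Q').2.2 - (sval Q').2.1 = (d - c) / 2].
    move=> h1 h2 h3 h4 h5 h6 h7 h8 h9.
    have okQ : ok ((a', b'), (c', d')).
      split; [split=> /=; lra|split; [split=> /=; lra|]].
      by rewrite /= h7 h8.
    by exists (exist _ _ okQ).
  have [h1|h1] := ltP s `|I a m c k|.
    by apply: (fin a m c k) => //; rewrite /m /k; lra.
  have [h2|h2] := ltP s `|I a m k d|.
    by apply: (fin a m k d) => //; rewrite /m /k; lra.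
  have [h3|h3] := ltP s `|I m b c k|.
    by apply: (fin m b c k) => //; rewrite /m /k; lra.
  have [h4|h4] := ltP s `|I m b k d|.
    by apply: (fin m b k d) => //; rewrite /m /k; lra.
  exfalso; lra.
have ok0 : ok ((x1, x2), (y1, y2)).
  split=> //; split=> //=; rewrite -/S /e mulrAC ltr_pdivrMr// mulrC.
  by have := sqr_ge0 S; nra.
have [nxt nxtP] := choice step.
pose Q n : T := iter n nxt (exist _ _ ok0).
pose a n := (sval (Q n)).1.1; pose b n := (sval (Q n)).1.2.
pose c n := (sval (Q n)).2.1; pose d n := (sval (Q n)).2.2.
have okQ n : ok (sval (Q n)) by case: (Q n).
have ab n : b n - a n = (x2 - x1) / 2 ^+ n.
  elim: n => [|n IH]; first by rewrite expr0 divr1.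
  have [[_ _ h] _] := nxtP (Q n).
  by rewrite /b /a /Q iterS -/(Q n) h -/(b n) -/(a n) IH exprSr invfM mulrA.
have cd n : d n - c n = (y2 - y1) / 2 ^+ n.
  elim: n => [|n IH]; first by rewrite expr0 divr1.
  have [_ [_ _ h]] := nxtP (Q n).
  by rewrite /d /c /Q iterS -/(Q n) h -/(d n) -/(c n) IH exprSr invfM mulrA.
(* The supremum of the left ends lies in every interval. *)
have nested (u v : nat -> R) : (forall n, u n <= u n.+1) -> (forall n, v n.+1 <= v n) ->
    (forall n, u n <= v n) -> exists p, forall n, u n <= p <= v n.
  move=> uS vS uv.
  have uv2 n m : u n <= v m.
    rewrite (@le_trans _ _ (u (maxn n m)))//.
      exact: (homo_leq (@lexx _ _) (@le_trans _ _) uS) (leq_maxl _ _).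
    rewrite (le_trans (uv _))//.
    have := @homo_leq _ (-%R \o v) <=%R (@lexx _ _) (@le_trans _ _) ltac:(by move=> k /=; rewrite lerN2) _ _ (leq_maxr n m).
    by rewrite /= lerN2.
  have hs : has_sup (range u).
    by split; [exists (u 0%N); exists 0%N|exists (v 0%N) => _ [n _ <-]].
  exists (sup (range u)) => n; apply/andP; split.
    by apply: (sup_upper_bound hs); exists n.
  by apply: ge_sup; [exact: hs.1|move=> _ [k _ <-]].
have [p pP] : exists p, forall n, a n <= p <= b n.
  apply: nested => n; rewrite /a /b /=.
  - by have [[]] := nxtP (Q n).
  - by have [[]] := nxtP (Q n).
  - by have [[]] := okQ n.
have [q qP] : exists q, forall n, c n <= q <= d n.
  apply: nested => n; rewrite /c /d /=.
  - by have [_ []] := nxtP (Q n).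
  - by have [_ []] := nxtP (Q n).
  - by have [_ [[]]] := okQ n.
have [r r0 rP] := loc p q (pP 0%N) (qP 0%N) e e0.
have S0 : 0 <= S by rewrite /S; lra.
(* The half-perimeter after [n] halvings is [S / 2 ^+ n]; it drops below [r] because [n < 2 ^ n]. *)
have [n nP] : exists n, S / 2 ^+ n < r.
  have /andP[_ h] := @truncn_itv R (S / r) ltac:(by rewrite divr_ge0// ltW).
  exists (Num.truncn (S / r)).+1; rewrite ltr_pdivrMr ?exprn_gt0// -ltr_pdivrMl// mulrC.
  by rewrite (lt_trans h)// -natrX ltr_nat ltn_expl.
have [[x1a _ bx2] [[y1c _ dy2] bad]] := okQ n.
have n2 : 0 <= (2 ^+ n)^-1 :> R by rewrite invr_ge0 exprn_ge0.
have := rP (a n) (b n) (c n) (d n).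
have /andP[-> ->] := pP n; have /andP[-> ->] := qP n.
rewrite x1a bx2 y1c dy2 ab cd => /(_ isT isT isT isT) h.
have /h{}h : (x2 - x1) / 2 ^+ n < r.
  by rewrite (le_lt_trans _ nP)// ler_wpM2r// /S; lra.
have /h{}h : (y2 - y1) / 2 ^+ n < r.
  by rewrite (le_lt_trans _ nP)// ler_wpM2r// /S; lra.
by move: bad; rewrite ltNge => /negP; apply; rewrite -ab -cd in h.
Qed.

(** * Integrals over intervals and affine substitutions *)

Section itv_integral.
Variable R : realType.
Local Notation mu := (@lebesgue_measure R).
Implicit Types (f : R -> R) (a b c : R).

Lemma Rintegral_itv_add f a b c : a <= b -> b <= c ->
  {within `[a, c], continuous f} ->
  (\int[mu]_(x in `[a, c]) f x =
   \int[mu]_(x in `[a, b]) f x + \int[mu]_(x in `[b, c]) f x)%R.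
Proof.
move=> ab bc cf.
have fi : mu.-integrable `[a, c] (EFin \o f).
  by apply: continuous_compact_integrable => //; exact: segment_compact.
have := Rintegral_itvB fi (_ : BLeft a <= BRight b)%O (_ : BRight b <= BRight c)%O.
rewrite !bnd_simp => /(_ ab bc).
rewrite Rintegral_itv_obnd_cbnd; last first.
  by apply: integrableS fi => //; apply: subset_itvr; rewrite bnd_simp.
by move=> <-; rewrite addrCA subrr addr0.
Qed.

Lemma Rintegral_itv_le (f g : R -> R) a b : {within `[a, b], continuous f} ->
  {within `[a, b], continuous g} ->
  (forall x, a <= x <= b -> f x <= g x) ->
  \int[mu]_(x in `[a, b]) f x <= \int[mu]_(x in `[a, b]) g x.
Proof.
move=> cf cg fg; apply: le_Rintegral => //.
- by apply: continuous_compact_integrable => //; exact: segment_compact.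
- by apply: continuous_compact_integrable => //; exact: segment_compact.
Qed.

Lemma Rintegral_itv_cst k a b : a <= b -> \int[mu]_(x in `[a, b]) k = k * (b - a).
Proof.
move=> ab; rewrite Rintegral_cst//= lebesgue_measure_itv/= lte_fin.
by move: ab; rewrite le_eqVlt => /predU1P[->|->//]; rewrite ltxx subrr.
Qed.

Lemma Rintegral_itv_approx f k e a b : a <= b -> {within `[a, b], continuous f} ->
  (forall x, a <= x <= b -> `|f x - k| <= e) ->
  `|\int[mu]_(x in `[a, b]) f x - k * (b - a)| <= e * (b - a).
Proof.
move=> ab cf fk.
have cc (l : R) : {within `[a, b], continuous (fun=> l)} by apply: continuous_subspaceT => x; exact: cvg_cst.
have h1 : \int[mu]_(x in `[a, b]) f x <= (k + e) * (b - a).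
  rewrite -Rintegral_itv_cst//; apply: Rintegral_itv_le => // x /fk.
  by rewrite ler_norml; lra.
have h2 : (k - e) * (b - a) <= \int[mu]_(x in `[a, b]) f x.
  rewrite -Rintegral_itv_cst//; apply: Rintegral_itv_le => // x /fk.
  by rewrite ler_norml; lra.
by rewrite ler_norml; apply/andP; split; nra.
Qed.

End itv_integral.

Section affine.
Variable R : realType.
Local Notation mu := (@lebesgue_measure R).
Local Open Scope ereal_scope.

Let aff (c d : R) (x : measurableTypeR R) : measurableTypeR R := (c * x + d)%R.

Let measurable_aff c d : measurable_fun setT (aff c d).
Proof. by apply: measurable_funD => //; apply: measurable_funM. Qed.

Let aff_image c d : set (measurableTypeR R) -> \bar R := pushforward mu (aff c d).

HB.instance Definition _ c d := Measure.copy (aff_image c d)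
  (measure_function_pushforward__canonical__measure_function_Measure mu (measurable_aff c d)).

(** By uniqueness of Lebesgue measure it suffices to compare both sides on the intervals []a, b]],
    whose preimages have length [(b - a) / c]. *)
Let pushforward_aff (c d : R) (c0 : (0 < c)%R) (A : set R) : measurable A ->
  mu A = c%:E * aff_image c d A.
Proof.
move=> mA; have c0' : (0 <= c)%R by rewrite ltW.
apply: (@lebesgue_measure_unique _ (mscale (NngNum c0') (aff_image c d))) => //= _ [[a b]] _ <-.
have aE : aff c d @^-1` `]a, b] = `]((a - d) / c)%R, ((b - d) / c)%R]%classic.
  apply/seteqP; split=> x /=; rewrite !in_itv/= /aff ltr_pdivrMr// ler_pdivlMr// [(x * c)%R]mulrC;
    by rewrite ltrBlDr lerBrDr.
rewrite /mscale/= /aff_image /pushforward aE !lebesgue_measure_itv/= !lte_fin.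
rewrite ltr_pM2r ?invr_gt0// ltrD2r; case: ifP => _; last by rewrite mule0.
rewrite -!EFinB -EFinM; congr (_%:E); field.
by rewrite gt_eqF.
Qed.

Let ge0_integral_affine_pos (f : R -> \bar R) (c d : R) : (0 < c)%R ->
  measurable_fun setT f -> (forall x, 0 <= f x) ->
  \int[mu]_x f x = c%:E * \int[mu]_x f (c * x + d)%R.
Proof.
move=> c0 mf f0; have c0' : (0 <= c)%R by rewrite ltW.
have <- : \int[aff_image c d]_x f x = \int[mu]_x f (c * x + d)%R.
  by rewrite ge0_integral_pushforward.
transitivity (\int[mscale (NngNum c0') (aff_image c d)]_x f x).
  by apply: eq_measure_integral => A mA _; exact: pushforward_aff.
by rewrite ge0_integral_mscale.
Qed.

Lemma ge0_integral_opp (f : R -> \bar R) :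
  measurable_fun setT f -> (forall x, 0 <= f x) ->
  \int[mu]_x f x = \int[mu]_x f (- x)%R.
Proof.
move=> mf f0.
transitivity (\int[mu]_(x in (-%R : _ -> measurableTypeR R) @^-1` setT) (f \o -%R) x) => //.
rewrite -ge0_integral_pushforward//=.
by apply: eq_measure_integral => //= A mA _; exact/esym/lebesgue_measureN.
Qed.

Lemma ge0_integral_affine (f : R -> \bar R) (c d : R) : c != 0%R ->
  measurable_fun setT f -> (forall x, 0 <= f x) ->
  \int[mu]_x f x = `|c|%:E * \int[mu]_x f (c * x + d)%R.
Proof.
move=> + mf f0; rewrite neq_lt => /orP[c0|c0]; last first.
  by rewrite gtr0_norm//; exact: ge0_integral_affine_pos.
(* A negative slope is a positive one composed with the reflection [x -> - x]. *)
have nc0 : (0 < - c)%R by rewrite oppr_gt0.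
rewrite ltr0_norm// (ge0_integral_affine_pos d nc0)//; congr (_ * _).
rewrite ge0_integral_opp//.
- by apply: eq_integral => x _; rewrite mulrNN.
- by apply: measurableT_comp => //; exact: (measurable_aff (- c) d).
Qed.

End affine.

(** * Closed forms on rectangles *)

Section form.
Variable R : realType.
Local Notation mu := (@lebesgue_measure R).
(* The last hypothesis says that A du + S dt is closed: K is the common value
   at (p, q) of the derivatives of A in t and of S in u. *)
Lemma closed_form_rectangle (A S : R -> R -> R) (x1 x2 y1 y2 : R) :
  x1 <= x2 -> y1 <= y2 ->
  (forall t, y1 <= t <= y2 -> {within `[x1, x2], continuous (A^~ t)}) ->
  (forall u, x1 <= u <= x2 -> {within `[y1, y2], continuous (S u)}) ->
  (forall p q, x1 <= p <= x2 -> y1 <= q <= y2 -> exists K, forall e, 0 < e ->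
     exists2 r, 0 < r & forall a b c d, x1 <= a <= p -> p <= b <= x2 ->
       y1 <= c <= q -> q <= d <= y2 -> b - a < r -> d - c < r ->
       (forall u, a <= u <= b ->
          `|A u c - A u d - - K * (d - c)| <= e * (b - a + (d - c))) /\
       (forall t, c <= t <= d ->
          `|S b t - S a t - K * (b - a)| <= e * (b - a + (d - c)))) ->
  \int[mu]_(u in `[x1, x2]) A u y1 - \int[mu]_(u in `[x1, x2]) A u y2 =
  \int[mu]_(t in `[y1, y2]) S x1 t - \int[mu]_(t in `[y1, y2]) S x2 t.
Proof.
move=> x12 y12 cA cS loc.
(* [I] is the counterclockwise boundary integral of the form, known only through its equation so
   that it stays folded. *)
have [I IE] : exists I : R -> R -> R -> R -> R, forall a b c d, I a b c d =
    \int[mu]_(u in `[a, b]) A u c - \int[mu]_(u in `[a, b]) A u d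
    + (\int[mu]_(t in `[c, d]) S b t - \int[mu]_(t in `[c, d]) S a t).
  by exists (fun a b c d => \int[mu]_(u in `[a, b]) A u c - \int[mu]_(u in `[a, b]) A u d
    + (\int[mu]_(t in `[c, d]) S b t - \int[mu]_(t in `[c, d]) S a t)).
have cAs a b t : x1 <= a -> b <= x2 -> y1 <= t <= y2 ->
    {within `[a, b], continuous (A^~ t)}.
  move=> xa bx yt; apply: continuous_subspaceW (cA t yt).
  by apply: subset_itv; rewrite bnd_simp.
have cSs c d u : y1 <= c -> d <= y2 -> x1 <= u <= x2 ->
    {within `[c, d], continuous (S u)}.
  move=> xa bx yt; apply: continuous_subspaceW (cS u yt).
  by apply: subset_itv; rewrite bnd_simp.
suff : I x1 x2 y1 y2 = 0 by move=> /eqP; rewrite IE addr_eq0 opprB => /eqP.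
apply: additive_rectangle_eq0 => //.
- move=> a m b c d x1a am mb bx2 y1c cd dy2; rewrite !IE.
  rewrite (@Rintegral_itv_add _ (A^~ c) a m b)//; last by apply: cAs => //; lra.
  rewrite (@Rintegral_itv_add _ (A^~ d) a m b)//; last by apply: cAs => //; lra.
  by ring.
- move=> a b c m d x1a ab bx2 y1c cm md dy2; rewrite !IE.
  rewrite (@Rintegral_itv_add _ (S a) c m d)//; last by apply: cSs => //; lra.
  rewrite (@Rintegral_itv_add _ (S b) c m d)//; last by apply: cSs => //; lra.
  by ring.
move=> p q pP qP e e0; have [K KP] := loc p q pP qP.
have [r r0 rP] := KP e e0; exists r => // a b c d ha hb hc hd bar dcr.
have [h1 h2] := rP a b c d ha hb hc hd bar dcr.
have cA' t : y1 <= t <= y2 -> {within `[a, b], continuous (A^~ t)}.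
  by move=> yt; apply: cAs => //; lra.
have cS' u : x1 <= u <= x2 -> {within `[c, d], continuous (S u)}.
  by move=> yt; apply: cSs => //; lra.
have iA t : y1 <= t <= y2 -> mu.-integrable `[a, b] (EFin \o (A^~ t)).
  by move=> yt; apply: continuous_compact_integrable; [exact: segment_compact|exact: cA'].
have iS u : x1 <= u <= x2 -> mu.-integrable `[c, d] (EFin \o (S u)).
  by move=> yt; apply: continuous_compact_integrable; [exact: segment_compact|exact: cS'].
rewrite !IE -RintegralB//; [|by apply: iA; lra|by apply: iA; lra].
rewrite -RintegralB//; [|by apply: iS; lra|by apply: iS; lra].
have ab : a <= b by lra.
have cd : c <= d by lra.
have cAB : {within `[a, b], continuous (fun u => A u c - A u d)}.
  by move=> x; apply: cvgB; [apply: cA'; lra|apply: cA'; lra].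
have cSB : {within `[c, d], continuous (fun t => S b t - S a t)}.
  by move=> x; apply: cvgB; [apply: cS'; lra|apply: cS'; lra].
(* The terms in [K] cancel in [X + Y], and the two errors add up to [e] times the squared
   half-perimeter. *)
have gen X Y : `|X - - K * (d - c) * (b - a)| <= e * (b - a + (d - c)) * (b - a) ->
    `|Y - K * (b - a) * (d - c)| <= e * (b - a + (d - c)) * (d - c) ->
    `|X + Y| <= e * (b - a + (d - c)) ^+ 2.
  rewrite !ler_norml expr2 => /andP[? ?] /andP[? ?].
  by apply/andP; split; lra.
exact: gen (Rintegral_itv_approx ab cAB h1) (Rintegral_itv_approx cd cSB h2).
Qed.
End form.

(** * First-order expansions of holomorphic functions *)

Lemma derivable_eps (K : numFieldType) (g : K -> K) (z : K) : derivable g z 1 ->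
  exists l : K, forall e, 0 < e -> exists2 d, 0 < d & forall h, `|h| < d ->
    `|g (z + h) - g z - l * h| <= e * `|h|.
Proof.
move=> /cvg_ex[/= l gl]; exists l => e e0.
move/cvgrPdist_lt : gl => /(_ _ e0).
rewrite near_withinE => /nbhs_ballP[d /= d0 dP].
exists d => // h hd; have [->|h0] := eqVneq h 0.
  by rewrite addr0 subrr mulr0 subrr normr0 mulr0.
have : ball 0 d h by rewrite /ball/= sub0r normrN.
move=> /dP/(_ h0).
rewrite (_ : h%:A = h); last by rewrite /GRing.scale/= mulr1.
rewrite [h + z]addrC distrC => /ltW H.
rewrite (_ : _ - l * h = (h^-1 * (g (z + h) - g z) - l) * h); last first.
  by rewrite mulrBl mulrAC mulVf// mul1r.
by rewrite normrM ler_wpM2r.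
Qed.

Section expansion.
Variable R : realType.
Local Notation C := R[i].
Implicit Type g : C -> C.

Lemma normr_complex (z : C) : `|z| = (normc z)%:C.
Proof. by case: z. Qed.

Lemma normc_ge0 (z : C) : 0 <= normc z.
Proof. by case: z => x y; exact: sqrtr_ge0. Qed.

Lemma normc_ge_coord (x y : R) : `|x| <= normc (x +i* y) /\ `|y| <= normc (x +i* y).
Proof.
split; rewrite -[leLHS]sqrtr_sqr ler_wsqrtr// ?lerDl ?lerDr sqr_ge0//.
Qed.

Lemma normc_le_sum (x y : R) : normc (x +i* y) <= `|x| + `|y|.
Proof.
rewrite -[leRHS]ger0_norm ?addr_ge0// -sqrtr_sqr ler_wsqrtr//.
rewrite -(real_normK (num_real x)) -(real_normK (num_real y)).
by have := normr_ge0 x; have := normr_ge0 y; nra.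
Qed.

(** The derivative at [z] is [p + i q]. Its product with [h + i k] yields the two real linear forms,
    and this is how the Cauchy-Riemann equations enter the proof. *)
Lemma holomorphic_expansion (D : set C) g (z : C) : holomorphic_on D g -> D z ->
  exists p q : R, forall e, 0 < e -> exists2 r, 0 < r & forall h k : R,
    `|h| < r -> `|k| < r ->
    `|complex.Re (g (z + (h +i* k))) - complex.Re (g z) - (p * h - q * k)| <= e * (`|h| + `|k|) /\
    `|complex.Im (g (z + (h +i* k))) - complex.Im (g z) - (q * h + p * k)| <= e * (`|h| + `|k|).
Proof.
move=> hg /hg/derivable_eps[[p q] gl]; exists p, q => e e0.
have e0C : 0 < e%:C by rewrite ltcR.
have [[d d'] /= d0 dP] := gl _ e0C.
move: d0; rewrite ltcE/= => /andP[/eqP d'0 d0]; rewrite d'0 in dP.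
exists (d / 2); first by rewrite divr_gt0.
move=> h k hd kd.
have := dP (h +i* k); rewrite !normr_complex ltcR -rmorphM lecR.
have /[swap] /[apply] : normc (h +i* k) < d.
  by rewrite (le_lt_trans (normc_le_sum _ _))// (splitr d) ltrD.
move=> /le_trans H.
have {}H := H _ (ler_wpM2l (ltW e0) (normc_le_sum h k)).
case: (g (z + h +i* k)) (g z) H => [a b] [a' b'] /= H.
have [H1 H2] := normc_ge_coord (a - a' - (p * h - q * k)) (b - b' - (p * k + q * h)).
split; [exact: le_trans H1 H|rewrite [q * h + _]addrC; exact: le_trans H2 H].
Qed.

Lemma holomorphic_continuous (D : set C) g (x y : R -> R) (s : R) :
  holomorphic_on D g -> D (x s +i* y s) ->
  {for s, continuous x} -> {for s, continuous y} ->
  {for s, continuous (fun t => complex.Re (g (x t +i* y t)))} /\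
  {for s, continuous (fun t => complex.Im (g (x t +i* y t)))}.
Proof.
move=> hg Ds cx cy; have [p [q /(_ 1 ltr01)[r r0 H]]] := holomorphic_expansion hg Ds.
(* A local Lipschitz constant: [|p| + |q|] for the linear part and 1 for the remainder. *)
pose M := `|p| + `|q| + 1.
have M0 : 0 < M by rewrite /M ltr_wpDl// addr_ge0.
have bnd h k : `|h| < r -> `|k| < r ->
    `|complex.Re (g (x s +i* y s + (h +i* k))) - complex.Re (g (x s +i* y s))| <= M * (`|h| + `|k|) /\
    `|complex.Im (g (x s +i* y s + (h +i* k))) - complex.Im (g (x s +i* y s))| <= M * (`|h| + `|k|).
  move=> hr kr; have [H1 H2] := H h k hr kr.
  have E1 : `|p * h - q * k| <= `|p| * `|h| + `|q| * `|k|.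
    by rewrite (le_trans (ler_normB _ _))// !normrM.
  have E2 : `|q * h + p * k| <= `|q| * `|h| + `|p| * `|k|.
    by rewrite (le_trans (ler_normD _ _))// !normrM.
  have F1 := normr_ge0 p; have F2 := normr_ge0 q; have F3 := normr_ge0 h.
  have F4 := normr_ge0 k.
  split.
    rewrite -[X in `|X|](subrK (p * h - q * k)) (le_trans (ler_normD _ _))//.
    by rewrite (le_trans (lerD H1 E1))// /M; nra.
  rewrite -[X in `|X|](subrK (q * h + p * k)) (le_trans (ler_normD _ _))//.
  by rewrite (le_trans (lerD H2 E2))// /M; nra.
have near e : 0 < e -> \forall t \near s,
   `|complex.Re (g (x s +i* y s)) - complex.Re (g (x t +i* y t))| < e /\
   `|complex.Im (g (x s +i* y s)) - complex.Im (g (x t +i* y t))| < e.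
  move=> e0; pose d := Num.min r (e / (2 * M)).
  have d0 : 0 < d by rewrite lt_min r0 divr_gt0// mulr_gt0.
  move/cvgrPdist_lt : cx => /(_ _ d0) N1; move/cvgrPdist_lt : cy => /(_ _ d0) N2.
  apply: filterS2 N1 N2 => t; rewrite /= !lt_min (distrC (x s)) (distrC (y s)).
  move=> /andP[x1 x2] /andP[y1 y2].
  have := bnd _ _ x1 y1.
  rewrite (_ : x s +i* y s + _ = x t +i* y t); last first.
    by apply/eqP; rewrite eq_complex/=; apply/andP; split; apply/eqP; ring.
  have lt : M * (`|x t - x s| + `|y t - y s|) < e.
    rewrite mulrC -ltr_pdivlMr//; apply: (lt_le_trans (ltrD x2 y2)).
    by rewrite le_eqVlt; apply/orP; left; apply/eqP; field; rewrite gt_eqF.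
  rewrite (distrC (complex.Re (g (x s +i* y s)))) (distrC (complex.Im (g (x s +i* y s)))).
  by move=> [h1 h2]; split; exact: le_lt_trans lt.
split; apply/cvgrPdist_lt => e /near; by apply: filterS => t [].
Qed.

End expansion.

(** * Cone coordinates and a mean value inequality on squares *)

Section cone.
Variable R : realType.
Local Notation C := R[i].
Local Notation mu := (@lebesgue_measure R).
Variables (g : C -> C) (D : set C).
Hypothesis hg : holomorphic_on D g.

Definition cone_re (u t : R) := complex.Re (g (u +i* (u * t))).
Definition cone_im (u t : R) := complex.Im (g (u +i* (u * t))).
(* The imaginary part of g z * 'i / (1 + 'i t) at z = u (1 + 'i t). *)
Definition cone_kernel (u t : R) := (cone_re u t + t * cone_im u t) / (1 + t ^+ 2).

Lemma cone_continuousl (u t : R) : D (u +i* (u * t)) ->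
  {for u, continuous (cone_re^~ t)} /\ {for u, continuous (cone_im^~ t)}.
Proof.
move=> Du; apply: (@holomorphic_continuous _ D g id (fun u => u * t)) => //.
by apply: cvgM; [exact: cvg_id|exact: cvg_cst].
Qed.

Lemma cone_continuousr (u t : R) : D (u +i* (u * t)) ->
  {for t, continuous (cone_re u)} /\ {for t, continuous (cone_im u)}.
Proof.
move=> Du; apply: (@holomorphic_continuous _ D g (fun=> u) (fun t => u * t)) => //.
  exact: cvg_cst.
by apply: cvgM; [exact: cvg_cst|exact: cvg_id].
Qed.

Lemma cone_kernel_continuous (u t : R) : D (u +i* (u * t)) ->
  {for t, continuous (cone_kernel u)}.
Proof.
move=> Du; have [c1 c2] := cone_continuousr Du.
have p0 : 0 < 1 + t ^+ 2 by rewrite ltr_pwDl// sqr_ge0.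
apply: cvgM; first by apply: cvgD => //; apply: cvgM => //; exact: cvg_id.
apply: cvgV; first by rewrite gt_eqF.
by apply: cvgD; [exact: cvg_cst|apply: cvgM; exact: cvg_id].
Qed.

(** This is the closedness of the imaginary part of [g dz / z], whose coefficients are
    [cone_im u t / u] for [du] and [cone_kernel u t] for [dt]. With [g' = P + i Q] at the point, the
    derivative of the first in [t] and of the second in [u] are both [P]. *)
Lemma cone_form (x1 x2 : R) : 0 < x1 -> x1 <= x2 ->
  (forall u t, x1 <= u <= x2 -> -1 <= t <= 1 -> D (u +i* (u * t))) ->
  \int[mu]_(u in `[x1, x2]) (cone_im u (-1) / u) - \int[mu]_(u in `[x1, x2]) (cone_im u 1 / u) =
  \int[mu]_(t in `[-1, 1]) cone_kernel x1 t - \int[mu]_(t in `[-1, 1]) cone_kernel x2 t.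
Proof.
move=> x10 x12 hD.
apply: (@closed_form_rectangle _ (fun u t => cone_im u t / u) cone_kernel) => //.
- move=> t tI; apply: continuous_in_subspaceT => u /set_mem/=; rewrite in_itv/= => uI.
  apply: cvgM; first by have [] := cone_continuousl (hD u t uI tI).
  by apply: cvgV; [rewrite gt_eqF//; lra|exact: cvg_id].
- move=> u uI; apply: continuous_in_subspaceT => t /set_mem/=; rewrite in_itv/= => tI.
  exact: cone_kernel_continuous (hD u t uI tI).
move=> p q pI qI; have [P [Q HPQ]] := holomorphic_expansion hg (hD p q pI qI).
exists P => e e0.
(* The factor [2 + x2] bounds the increments of [u] and [u * t] by the half-perimeter. The term
   [2 / x1] pays for two remainders divided by [u], and 4 for the remainders in [cone_kernel]. *)
pose M := (2 / x1 + 4) * (2 + x2).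
have x20 : 0 < x2 by lra.
have ix1 : 0 < x1^-1 by rewrite invr_gt0.
have M0 : 0 < M by rewrite mulr_gt0//; lra.
have eM0 : 0 < e / M by rewrite divr_gt0.
have [r r0 H] := HPQ _ eM0.
exists (r / (2 * (2 + x2))); first by rewrite divr_gt0// mulr_gt0//; lra.
move=> a b c d /andP[x1a ap] /andP[pb bx2] /andP[y1c cq] /andP[qd dy2].
rewrite !ltr_pdivlMr; [|lra|lra] => br dr.
have E u t : a <= u <= b -> c <= t <= d ->
    `|cone_re u t - cone_re p q - (P * (u - p) - Q * (u * t - p * q))| <= e / M * ((2 + x2) * (b - a + (d - c))) /\
    `|cone_im u t - cone_im p q - (Q * (u - p) + P * (u * t - p * q))| <= e / M * ((2 + x2) * (b - a + (d - c))).
  move=> /andP[au ub] /andP[ct td].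
  have up : `|u - p| <= b - a by rewrite ler_norml; apply/andP; split; lra.
  have tq : `|t - q| <= d - c by rewrite ler_norml; apply/andP; split; lra.
  have k1 : `|u * t - p * q| <= x2 * (d - c) + (b - a).
    rewrite (_ : _ - _ = u * (t - q) + q * (u - p)); last by ring.
    rewrite (le_trans (ler_normD _ _))// !normrM lerD//.
      by rewrite ler_pM// ger0_norm; lra.
    by rewrite -[leRHS]mul1r ler_pM// ler_norml; apply/andP; split; lra.
  have ba : 0 <= b - a by lra.
  have dc : 0 <= d - c by lra.
  have s1 : (b - a + (x2 * (d - c) + (b - a))) <= (2 + x2) * (b - a + (d - c)) by nra.
  have := H (u - p) (u * t - p * q).
  rewrite (_ : p +i* (p * q) + _ = u +i* (u * t)); last first.
    by apply/eqP; rewrite eq_complex/=; apply/andP; split; apply/eqP; ring.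
  have hr : `|u - p| < r by nra.
  have kr : `|u * t - p * q| < r by rewrite (le_lt_trans k1)//; nra.
  move=> /(_ hr kr)[h1 h2].
  have s2 : e / M * (`|u - p| + `|u * t - p * q|) <= e / M * ((2 + x2) * (b - a + (d - c))).
    by rewrite ler_pM2l//; lra.
  by split; [exact: le_trans h1 s2|exact: le_trans h2 s2].
set s := b - a + (d - c) in E *.
have s0 : 0 <= s by rewrite /s; lra.
set m := e / M * _ in E.
have mE : (2 / x1 + 4) * m = e * s.
  by rewrite /m /M; field; rewrite !gt_eqF//; nra.
have m0 : 0 <= m by apply: mulr_ge0; [exact: ltW|apply: mulr_ge0 => //; lra].
split.
  move=> u uI.
  have cI : c <= c <= d by lra.
  have dI : c <= d <= d by lra.
  have [_ h1] := E u c uI cI; have [_ h2] := E u d uI dI.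
  have u0 : 0 < u by lra.
  rewrite (_ : _ - _ = ((cone_im u c - cone_im p q - (Q * (u - p) + P * (u * c - p * q))) -
    (cone_im u d - cone_im p q - (Q * (u - p) + P * (u * d - p * q)))) / u); last first.
    by field; rewrite gt_eqF.
  rewrite normrM normfV (gtr0_norm u0) ler_pdivrMr//.
  rewrite (le_trans (ler_normB _ _))// (le_trans (lerD h1 h2))// -mE.
  have : 2 * m / x1 * x1 = 2 * m by rewrite divfK// gt_eqF.
  have : 0 <= 2 * m / x1 by rewrite divr_ge0//; lra.
  rewrite (_ : (2 / x1 + 4) * m * u = 2 * m / x1 * u + 4 * m * u); last by ring.
  by nra.
move=> t tI.
have aI : a <= a <= b by lra.
have bI : a <= b <= b by lra.
have [h1 h2] := E a t aI tI; have [h3 h4] := E b t bI tI.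
have t1 : `|t| <= 1 by rewrite ler_norml; apply/andP; split; lra.
have p0 : 0 < 1 + t ^+ 2 by rewrite ltr_pwDl// sqr_ge0.
set ra := cone_re a t - _ - _ in h1; set ia := cone_im a t - _ - _ in h2.
set rb := cone_re b t - _ - _ in h3; set ib := cone_im b t - _ - _ in h4.
(* The linear parts contribute exactly [P * (b - a) * (1 + t ^+ 2)] to the numerator, the terms in
   [Q] cancelling; only remainders are left. *)
rewrite (_ : _ - _ = (rb - ra + t * (ib - ia)) / (1 + t ^+ 2)); last first.
  by rewrite /ra /ia /rb /ib /cone_kernel; field; rewrite gt_eqF.
rewrite normrM normfV (gtr0_norm p0) ler_pdivrMr//.
apply: (@le_trans _ _ (4 * m)).
  rewrite (le_trans (ler_normD _ _))// normrM.
  have := le_trans (ler_normB rb ra) (lerD h3 h1).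
  have := le_trans (ler_normB ib ia) (lerD h4 h2).
  have := normr_ge0 (ib - ia); have := normr_ge0 t; nra.
have : 0 <= e * s by rewrite mulr_ge0// ltW.
have : 4 * m <= e * s by rewrite -mE ler_wpM2r// lerDr divr_ge0// ltW.
by have := sqr_ge0 t; nra.
Qed.
End cone.

Lemma holomorphic_on_affine (K : numFieldType) (D : set K) (g : K -> K) (c w : K) :
  holomorphic_on D g ->
  holomorphic_on [set z | D (c * z + w)] (fun z => g (c * z + w)).
Proof.
move=> hg z Dz; apply/derivable1_diffP.
apply: (@differentiable_comp _ _ _ _ (fun z => c * z + w) g).
  apply/derivable1_diffP; apply: derivableD; last exact: derivable_cst.
  by apply: derivableM; [exact: derivable_cst|exact: derivable_id].
exact/derivable1_diffP/hg.
Qed.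

Lemma holomorphic_onM (K : numFieldType) (D : set K) (f g : K -> K) :
  holomorphic_on D f -> holomorphic_on D g ->
  holomorphic_on D (fun z => f z * g z).
Proof. by move=> hf hg z Dz; apply: derivableM; [exact: hf|exact: hg]. Qed.

Section mean_value.
Variable R : realType.
Local Notation C := R[i].
Local Notation mu := (@lebesgue_measure R).
Local Notation H := (@right_half_plane R).

Lemma cone_kernel_bounds (g : C -> C) (u t : R) : -1 <= t <= 1 ->
  cone_kernel g u t <= 2 * normc (g (u +i* (u * t))).
Proof.
move=> tI; have p0 : 0 < 1 + t ^+ 2 by rewrite ltr_pwDl// sqr_ge0.
rewrite /cone_kernel ler_pdivrMr// /cone_re /cone_im.
case: (g _) => a b.
have [] := normc_ge_coord a b; move: (normc (a +i* b)) => n /=.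
rewrite !ler_norml => /andP[a1 a2] /andP[b1 b2].
have n0 : 0 <= n by lra.
have : t * b <= n by nra.
by have := mulr_ge0 n0 (sqr_ge0 t); lra.
Qed.

(** The boundary of the square of half-side [u] about [w] consists of four sides
    [w + i^k u (1 + i t)]. Summing [cone_form] over the four cones, the integrals along the
    diagonals cancel, so the sum of the kernel integrals does not depend on the size of the square.
    A small square bounds it below by about [4 * n ^+ 2], the given one bounds it above by [2 * n]
    times the right-hand side. *)
Lemma normc_mean_value (f : C -> C) (x y u : R) : holomorphic_on H f -> 0 < u < x ->
  2 * normc (f (x +i* y)) <=
    \int[mu]_(t in `[-1, 1]) normc (f ((x + u) +i* (y + u * t))) +
    \int[mu]_(t in `[-1, 1]) normc (f ((x - u * t) +i* (y + u))) +
    \int[mu]_(t in `[-1, 1]) normc (f ((x - u) +i* (y - u * t))) +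
    \int[mu]_(t in `[-1, 1]) normc (f ((x + u * t) +i* (y - u))).
Proof.
move=> hf /andP[u0 ux].
pose N a b := normc (f (a +i* b)); rewrite -/(N _ _).
pose w : C := x +i* y.
pose n := N x y; have n0 : 0 <= n by exact: normc_ge0.
(* The conjugate factor makes the value at [w] the real number [n ^+ 2], so that the kernel is
   nearly [n ^+ 2 / (1 + t ^+ 2)] on small squares. *)
pose F z := (f w)^*%C * f z.
have hF : holomorphic_on H F by exact: holomorphic_onZ.
pose g c z := F (c * z + w).
pose D (c : C) := [set z | H (c * z + w)].
have hg c : holomorphic_on (D c) (g c) by exact: holomorphic_on_affine.
pose c0 : C := 1 +i* 0; pose c1 : C := 0 +i* 1.
pose c2 : C := (-1) +i* 0; pose c3 : C := 0 +i* (-1).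
have hD c : c \in [:: c0; c1; c2; c3] -> forall v t, 0 < v <= u -> -1 <= t <= 1 -> D c (v +i* (v * t)).
  move=> cs v t vI tI; rewrite /D /right_half_plane /=.
  have h1 : - v <= v * t by nra.
  have h2 : v * t <= v by nra.
  move: cs; rewrite !inE => /or4P[] /eqP -> /=; lra.
pose J c v := \int[mu]_(t in `[-1, 1]) cone_kernel (g c) v t.
pose E c s v := \int[mu]_(z in `[v, u]) (cone_im (g c) z s / z).
have JE c v : c \in [:: c0; c1; c2; c3] -> 0 < v <= u -> E c (-1) v - E c 1 v = J c v - J c u.
  move=> cs /andP[v0 vu]; apply: (cone_form (hg c)) => // z t zI tI.
  by apply: hD => //; lra.
(* Adjacent cones share a diagonal: [i^(k+1) (1 - i) = i^k (1 + i)]. *)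
have rot v : [/\ E c1 (-1) v = E c0 1 v, E c2 (-1) v = E c1 1 v,
    E c3 (-1) v = E c2 1 v & E c0 (-1) v = E c3 1 v].
  by split; apply: eq_Rintegral => z _; rewrite /cone_im /g; congr (complex.Im (F _) / _);
   apply/eqP; rewrite eq_complex/=; apply/andP; split; apply/eqP; ring.
have Jconst v : 0 < v <= u -> J c0 v + J c1 v + J c2 v + J c3 v = J c0 u + J c1 u + J c2 u + J c3 u.
  move=> vI.
  have e0 := JE c0 v ltac:(by rewrite !inE eqxx ?orbT) vI.
  have e1 := JE c1 v ltac:(by rewrite !inE eqxx ?orbT) vI.
  have e2 := JE c2 v ltac:(by rewrite !inE eqxx ?orbT) vI.
  have e3 := JE c3 v ltac:(by rewrite !inE eqxx ?orbT) vI.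
  have [r1 r2 r3 r4] := rot v.
  rewrite r1 in e1; rewrite r2 in e2; rewrite r3 in e3; rewrite r4 in e0.
  move: e0 e1 e2 e3; clear.
  move: (J c0 v) (J c1 v) (J c2 v) (J c3 v) (J c0 u) (J c1 u) (J c2 u) (J c3 u)
    (E c0 1 v) (E c1 1 v) (E c2 1 v) (E c3 1 v) => *; lra.
have kc c v : c \in [:: c0; c1; c2; c3] -> 0 < v <= u -> {within `[-1, 1], continuous (cone_kernel (g c) v)}.
  move=> cs vI; apply: continuous_in_subspaceT => t /set_mem/=; rewrite in_itv/= => tI.
  by apply: (cone_kernel_continuous (hg c)); exact: hD.
(* Since [1 / (1 + t ^+ 2)] is at least [1 / 2] on an interval of length 2, each cone contributes at
   least [n ^+ 2] up to an error. *)
have lower e : 0 < e -> exists2 v, 0 < v <= u & forall c, c \in [:: c0; c1; c2; c3] ->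
    n ^+ 2 - e <= J c v.
  move=> e0; have xy : H (x +i* y) by rewrite /right_half_plane/=; lra.
  have e4 : 0 < e / 4 by lra.
  have [d d0 dP] := @holomorphic_near R F (x, y) _ hF xy e4.
  exists (Num.min u (d / 2)); first by rewrite lt_min u0 ge_min lexx divr_gt0.
  set v := Num.min u (d / 2).
  have vI : 0 < v <= u by rewrite /v lt_min u0 ge_min lexx divr_gt0.
  have vd : v <= d / 2 by rewrite /v ge_min lexx orbT.
  move: v vI vd => v vI vd c cs.
  have -> : n ^+ 2 - e = (n ^+ 2 / 2 - e / 2) * (1 - -1) by lra.
  rewrite -Rintegral_itv_cst; last by lra.
  apply: Rintegral_itv_le; [by move=> ?; exact: cvg_cst|exact: kc|].
  move=> t tI; have p0 : 0 < 1 + t ^+ 2 by rewrite ltr_pwDl// sqr_ge0.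
  rewrite /cone_kernel ler_pdivlMr//.
  have Fw : F w = (n ^+ 2)%:C.
    rewrite /F /n /N -/w; case: (f w) => a b; rewrite /= sqr_sqrtr ?addr_ge0 ?sqr_ge0//.
    by apply/eqP; rewrite eq_complex/=; apply/andP; split; apply/eqP; ring.
  have [z1 [z2 [zE [z1x z2y]]]] : exists z1 z2 : R, c * (v +i* (v * t)) + w = z1 +i* z2 /\
      `|z1 - x| <= v /\ `|z2 - y| <= v.
    have vt : `|v * t| <= v by rewrite ler_norml; apply/andP; split; nra.
    have vv : `|v| <= v by rewrite ger0_norm; lra.
    have zz (s : R) : s = v * t \/ s = - (v * t) \/ s = v \/ s = - v -> `|s| <= v.
      by case=> [->//|[->|[->//|->]]]; rewrite normrN.
    exists (complex.Re (c * (v +i* (v * t)) + w)), (complex.Im (c * (v +i* (v * t)) + w)).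
    split; first by case: (_ + w).
    by move: cs; rewrite !inE => /or4P[] /eqP -> /=; split; apply: zz;
      rewrite addrK; do ?[by left; ring|right]; ring.
  have [_] := dP (z1, z2) ltac:(rewrite /=; lra) ltac:(rewrite /=; lra).
  rewrite /= -/w -zE -/(g c (v +i* (v * t))) Fw /cone_re /cone_im.
  case: (g c _) => a b; rewrite -[_ - _]/((n ^+ 2 - a) +i* (0 - b)).
  have [+ +] := normc_ge_coord (n ^+ 2 - a) (0 - b).
  move: (normc _) => m /= h1 h2 m4.
  have : `|n ^+ 2 - a| < e / 4 by exact: le_lt_trans h1 m4.
  have : `|0 - b| < e / 4 by exact: le_lt_trans h2 m4.
  rewrite !ltr_norml => /andP[b1 b2] /andP[a1 a2].
  have : - (e / 4) <= t * b by nra.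
  have : t ^+ 2 <= 1 by rewrite expr2; nra.
  move: (sqr_ge0 n) (sqr_ge0 t) p0 a1 a2; move: (n ^+ 2) (t ^+ 2) => n2 t2 n20 t20 p0 a1 a2 t21 tb.
  (* The factor [1 + t ^+ 2] lies between 1 and 2; the sign decides which of the two bounds is the
     relevant one. *)
  have [neg|pos] := ltP (n2 / 2 - e / 2) 0; first by nra.
  by nra.
have upper c X Y : c \in [:: c0; c1; c2; c3] -> continuous X -> continuous Y ->
    (forall t, c * (u +i* (u * t)) + w = X t +i* Y t) ->
    J c u <= 2 * n * \int[mu]_(t in `[-1, 1]) N (X t) (Y t).
  move=> cs cX cY XY.
  have uI : 0 < u <= u by lra.
  have cN : {within `[-1, 1], continuous (fun t => N (X t) (Y t))}.
    apply: continuous_in_subspaceT => t /set_mem/=; rewrite in_itv/= => tI.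
    have XYt : H (X t +i* Y t) by rewrite -XY; exact: hD.
    have [k1 k2] := holomorphic_continuous hf XYt (cX t) (cY t).
    rewrite /N (_ : (fun t => _) = (fun t => Num.sqrt (complex.Re (f (X t +i* Y t)) ^+ 2 +
      complex.Im (f (X t +i* Y t)) ^+ 2))); last by apply/funext => s; case: (f _).
    apply: continuous_comp; last exact: sqrt_continuous.
    by apply: cvgD; apply: cvgM.
  rewrite -RintegralZl//; last by apply: continuous_compact_integrable => //; exact: segment_compact.
  apply: Rintegral_itv_le; [exact: kc|by move=> ?; apply: cvgM; [exact: cvg_cst|exact: cN]|].
  move=> t tI; apply: le_trans (cone_kernel_bounds _ _ tI) _.
  rewrite /g XY /F normcM -mulrA ler_wpM2l// /n /N -/w.
  by case: (f w) => a b /=; rewrite sqrrN.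
have cp (k l : R) : continuous (fun t : R => k + l * t).
  by move=> t; apply: cvgD; [exact: cvg_cst|apply: cvgM; [exact: cvg_cst|exact: cvg_id]].
have cm (k l : R) : continuous (fun t : R => k - l * t).
  by move=> t; apply: cvgB; [exact: cvg_cst|apply: cvgM; [exact: cvg_cst|exact: cvg_id]].
have cc (k : R) : continuous (fun t : R => k) by move=> t; exact: cvg_cst.
have u0' := upper c0 _ _ ltac:(by rewrite !inE eqxx ?orbT) (cc (x + u)) (cp y u)
  ltac:(by move=> t; apply/eqP; rewrite eq_complex/=; apply/andP; split; apply/eqP; ring).
have u1' := upper c1 _ _ ltac:(by rewrite !inE eqxx ?orbT) (cm x u) (cc (y + u))
  ltac:(by move=> t; apply/eqP; rewrite eq_complex/=; apply/andP; split; apply/eqP; ring).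
have u2' := upper c2 _ _ ltac:(by rewrite !inE eqxx ?orbT) (cc (x - u)) (cm y u)
  ltac:(by move=> t; apply/eqP; rewrite eq_complex/=; apply/andP; split; apply/eqP; ring).
have u3' := upper c3 _ _ ltac:(by rewrite !inE eqxx ?orbT) (cp x u) (cc (y - u))
  ltac:(by move=> t; apply/eqP; rewrite eq_complex/=; apply/andP; split; apply/eqP; ring).
have i0 (h : R -> C) : 0 <= \int[mu]_(t in `[-1, 1]) normc (h t).
  by apply: Rintegral_ge0 => t _; exact: normc_ge0.
have := i0 (fun t => f ((x + u) +i* (y + u * t))); have := i0 (fun t => f ((x - u * t) +i* (y + u))).
have := i0 (fun t => f ((x - u) +i* (y - u * t))); have := i0 (fun t => f ((x + u * t) +i* (y - u))).
rewrite -/n; move: u0' u1' u2' u3'; rewrite /N.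
set I0 := Rintegral _ _ _; set I1 := Rintegral _ _ _; set I2 := Rintegral _ _ _; set I3 := Rintegral _ _ _.
move: I0 I1 I2 I3 => I0 I1 I2 I3 u0' u1' u2' u3' p3 p2 p1 p0.
have key e : 0 < e -> 4 * (n ^+ 2 - e) <= 2 * n * (I0 + I1 + I2 + I3).
  move=> /lower[v vI low]; have := Jconst v vI.
  have := low c0 ltac:(by rewrite !inE eqxx ?orbT).
  have := low c1 ltac:(by rewrite !inE eqxx ?orbT).
  have := low c2 ltac:(by rewrite !inE eqxx ?orbT).
  have := low c3 ltac:(by rewrite !inE eqxx ?orbT).
  move: u0' u1' u2' u3'; clear.
  move: (J c0 v) (J c1 v) (J c2 v) (J c3 v) (J c0 u) (J c1 u) (J c2 u) (J c3 u) => *; lra.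
clear -key n0 p0 p1 p2 p3; move: n n0 key => n n0 key.
(* The limit [e -> 0]: a positive gap between the two sides would contradict [key] at one eighth of
   that gap. *)
have {}key : 4 * n ^+ 2 <= 2 * n * (I0 + I1 + I2 + I3).
  by rewrite leNgt; apply/negP => lt; have := key ((4 * n ^+ 2 - 2 * n * (I0 + I1 + I2 + I3)) / 8) ltac:(lra); lra.
move: n0; rewrite le_eqVlt => /predU1P[<-|n0]; first by lra.
rewrite -(ler_pM2l n0); move: key; rewrite expr2; lra.
Qed.
End mean_value.

(** * Point evaluations in the Bergman space *)

Section square_estimate.
Variable R : realType.
Local Notation C := R[i].
Local Notation mu := (@lebesgue_measure R).
Local Notation mu2 := (mu \x mu)%E.
Local Notation H := (@right_half_plane R).
Implicit Type f : C -> C.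

Lemma measurable_normc_holomorphic f : holomorphic_on H f ->
  measurable_fun [set p : R * R | H (p.1 +i* p.2)] (fun p => normc (f (p.1 +i* p.2))).
Proof.
move=> hf; apply: (measurability _ (RGenOInfty.measurableE R)) => //.
move=> _ [_ [c ->] <-]; apply: measurable_open_prod => p [Hp /=].
rewrite in_itv/= andbT => cp.
have [d d0 dP] := @holomorphic_near R f p (normc (f (p.1 +i* p.2)) - c) hf Hp
  ltac:(by rewrite subr_gt0).
exists d => // q q1 q2; have [Hq h] := dP q q1 q2; split=> //=.
rewrite in_itv/= andbT.
have := @le_normcD R (f (p.1 +i* p.2) - f (q.1 +i* q.2)) (f (q.1 +i* q.2)).
by rewrite subrK; move: h; lra.
Qed.

Lemma le_Rintegral_side (h : R -> \bar R) (c d : R) (phi : R -> R) : c != 0 ->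
  measurable_fun setT h -> (forall x, 0 <= h x)%E ->
  (forall t, -1 <= t <= 1 -> (phi t)%:E = h (c * t + d)) ->
  ((`|c| * \int[mu]_(t in `[-1, 1]) phi t)%:E <= \int[mu]_x h x)%E.
Proof.
move=> c0 mh h0 hphi; rewrite (ge0_integral_affine d c0 mh h0) EFinM.
apply: lee_wpmul2l; first by rewrite lee_fin.
apply: (@le_trans _ _ (\int[mu]_(t in `[(-1)%R, 1%R]) (phi t)%:E)%E).
  (* [Rintegral] takes the value 0 when the integral is infinite, so the inequality holds in that
     case too. *)
  rewrite /Rintegral; have : (0 <= \int[mu]_(t in `[(-1)%R, 1%R]) (phi t)%:E)%E.
    by apply: integral_ge0 => t; rewrite /= in_itv/= => /hphi ->.
  by case: (integral _ _ _) => //= _; rewrite leey.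
rewrite [leLHS](_ : _ = \int[mu]_(t in `[(-1)%R, 1%R]) h (c * t + d)%R)%E; last first.
  by apply: eq_integral => t /set_mem/=; rewrite in_itv/= => /hphi.
apply: ge0_subset_integral => //.
apply: (measurableT_comp mh).
by apply: measurable_funD => //; apply: measurable_funM.
Qed.

Definition square (x y r : R) : set (R * R) := `[x - r, x + r] `*` `[y - r, y + r].

Lemma measurable_square x y r : measurable (square x y r).
Proof. by apply: measurableX; exact: measurable_itv. Qed.

Lemma square_half_plane x y r : r < x -> square x y r `<=` [set p | H (p.1 +i* p.2)].
Proof.
by move=> rx [a b] [/=]; rewrite !in_itv/= /right_half_plane/= => /andP[+ _] _; lra.
Qed.

(** The mean value inequality is applied to [f ^+ 2] on the squares of half-side [u], multiplied by
    [u] and integrated over [r / 2 <= u <= r]. Each of the four moving sides contributes at most the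
    integral over the full square, and the interval has length [r / 2], whence [8 = 2 * 4]. *)
Lemma square_estimate f (x y r : R) : holomorphic_on H f -> 0 < r < x ->
  ((r ^+ 2 * normc (f (x +i* y)) ^+ 2)%:E <=
   8%:E * \int[mu2]_(p in square x y r) (normc (f (p.1 +i* p.2)) ^+ 2)%:E)%E.
Proof.
move=> hf /andP[r0 rx].
pose N (p : R * R) := (normc (f (p.1 +i* p.2)) ^+ 2)%:E.
rewrite integral_mkcond -/N.
set Phi := N \_ (square x y r).
have Phi0 p : (0 <= Phi p)%E.
  by apply: erestrict_ge0 => q _; rewrite lee_fin sqr_ge0.
have mPhi : measurable_fun setT Phi.
  apply/(measurable_restrictT _ (measurable_square x y r)).
  apply/measurable_EFinP/measurable_funX.
  apply: measurable_funS (measurable_normc_holomorphic hf); last exact: square_half_plane.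
  apply: measurable_open_prod => p Hp; exists p.1 => // q q1 _.
  by move: q1 Hp; rewrite /right_half_plane/= ltr_norml; lra.
have PhiN a b : x - r <= a <= x + r -> y - r <= b <= y + r ->
    Phi (a, b) = (normc (f (a +i* b) * f (a +i* b)))%:E.
  move=> ha hb; rewrite /Phi patchE mem_set.
    by rewrite /N/= normcM expr2.
  by split; rewrite /= in_itv.
(* [G] integrates over vertical lines and [G'] over horizontal ones; by Tonelli both integrate to
   the integral of [Phi]. *)
pose G a := (\int[mu]_b Phi (a, b))%E.
pose G' b := (\int[mu]_a Phi (a, b))%E.
have mG : measurable_fun setT G by exact: measurable_fun_fubini_tonelli_F.
have mG' : measurable_fun setT G' by exact: measurable_fun_fubini_tonelli_G.
have G0 a : (0 <= G a)%E by apply: integral_ge0.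
have G'0 a : (0 <= G' a)%E by apply: integral_ge0.
have m1 a : measurable_fun setT (fun b => Phi (a, b)).
  by apply: (measurableT_comp mPhi); exact: measurable_pair1.
have m2 b : measurable_fun setT (fun a => Phi (a, b)).
  by apply: (measurableT_comp mPhi); exact: measurable_pair2.
have hf2 : holomorphic_on H (fun z => f z * f z) by exact: holomorphic_onM.
pose k := normc (f (x +i* y)) ^+ 2.
have k0 : 0 <= k by exact: sqr_ge0.
have side u : r / 2 <= u <= r ->
    ((r * k)%:E <= G (x + u)%R + G (x - u)%R + (G' (y + u)%R + G' (y - u)%R))%E.
  move=> /andP[ru ur]; have u0 : 0 < u by lra.
  have ux : 0 < u < x by apply/andP; split; lra.
  have := normc_mean_value y hf2 ux; rewrite normcM -expr2 -/k.
  have un : u != 0 by rewrite gt_eqF.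
  have un' : - u != 0 by rewrite oppr_eq0.
  have tu t : -1 <= t <= 1 -> - r <= u * t <= r by move=> tI; apply/andP; split; nra.
  have := @le_Rintegral_side _ u y (fun t => normc (f ((x + u) +i* (y + u * t)) * f ((x + u) +i* (y + u * t)))) un (m1 (x + u)) ltac:(by []).
  have := @le_Rintegral_side _ (- u) y (fun t => normc (f ((x - u) +i* (y - u * t)) * f ((x - u) +i* (y - u * t)))) un' (m1 (x - u)) ltac:(by []).
  have := @le_Rintegral_side _ (- u) x (fun t => normc (f ((x - u * t) +i* (y + u)) * f ((x - u * t) +i* (y + u)))) un' (m2 (y + u)) ltac:(by []).
  have := @le_Rintegral_side _ u x (fun t => normc (f ((x + u * t) +i* (y - u)) * f ((x + u * t) +i* (y - u)))) un (m2 (y - u)) ltac:(by []).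
  rewrite normrN gtr0_norm// -/(G _) -/(G _) -/(G' _) -/(G' _).
  move: (Rintegral _ _ _) (Rintegral _ _ _) (Rintegral _ _ _) (Rintegral _ _ _) => i4 i3 i2 i1.
  move=> s1 s2 s3 s4 mv.
  have {}s1 : ((u * i1)%:E <= G' (y - u)%R)%E.
    apply: s1 => t /tu tI; rewrite -PhiN; [|by clear -tI u0 ur; lra|by clear -tI u0 ur; lra].
    by congr (Phi (_, _)); ring.
  have {}s2 : ((u * i2)%:E <= G' (y + u)%R)%E.
    apply: s2 => t /tu tI; rewrite -PhiN; [|by clear -tI u0 ur; lra|by clear -tI u0 ur; lra].
    by congr (Phi (_, _)); ring.
  have {}s3 : ((u * i3)%:E <= G (x - u)%R)%E.
    apply: s3 => t /tu tI; rewrite -PhiN; [|by clear -tI u0 ur; lra|by clear -tI u0 ur; lra].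
    by congr (Phi (_, _)); ring.
  have {}s4 : ((u * i4)%:E <= G (x + u)%R)%E.
    apply: s4 => t /tu tI; rewrite -PhiN; [|by clear -tI u0 ur; lra|by clear -tI u0 ur; lra].
    by congr (Phi (_, _)); ring.
  apply: (@le_trans _ _ (((u * i4)%:E + (u * i3)%:E + ((u * i2)%:E + (u * i1)%:E))%E)); last first.
    by rewrite !leeD.
  by rewrite -!EFinD lee_fin; nra.

pose F u := (G (x + u)%R + G (x - u)%R + (G' (y + u)%R + G' (y - u)%R))%E.
have mt (s z : R) : measurable_fun setT (fun u : R => z + s * u).
  by apply: measurable_funD => //; apply: measurable_funM.
have shift (h : R -> \bar R) (z s : R) : measurable_fun setT h -> (forall t, 0 <= h t)%E ->
    `|s| = 1 -> (\int[mu]_u h (z + s * u)%R = \int[mu]_u h u)%E.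
  move=> mh h0 s1; rewrite [RHS](@ge0_integral_affine _ h s z) ?s1 ?mul1e//.
    by apply: eq_integral => u _; rewrite addrC.
  by rewrite -normr_gt0 s1.
have FE u : F u = (G (x + 1 * u)%R + G (x + -1 * u)%R + (G' (y + 1 * u)%R + G' (y + -1 * u)%R))%E.
  by rewrite /F mul1r mulN1r.
have c1 (s z : R) : measurable_fun setT (fun u : R => G (z + s * u)) by exact: (measurableT_comp mG (mt s z)).
have c2 (s z : R) : measurable_fun setT (fun u : R => G' (z + s * u)) by exact: (measurableT_comp mG' (mt s z)).
have F0 u : (0 <= F u)%E by apply: adde_ge0; apply: adde_ge0.
have mF : measurable_fun setT F.
  have -> : F = (fun u => G (x + 1 * u)%R + G (x + -1 * u)%R + (G' (y + 1 * u)%R + G' (y + -1 * u)%R))%E.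
    by apply/funext => u; exact: FE.
  by apply: emeasurable_funD; apply: emeasurable_funD; [exact: c1|exact: c1|exact: c2|exact: c2].
have add2 (g1 g2 : R -> \bar R) : measurable_fun setT g1 -> measurable_fun setT g2 ->
    (forall t, 0 <= g1 t)%E -> (forall t, 0 <= g2 t)%E ->
    (\int[mu]_u (g1 u + g2 u) = \int[mu]_u g1 u + \int[mu]_u g2 u)%E.
  by move=> *; rewrite ge0_integralD.
have FI : (\int[mu]_u F u = 4%:E * \int[mu2]_p Phi p)%E.
  under eq_integral do rewrite FE.
  rewrite (add2 (fun u => G (x + 1 * u)%R + G (x + -1 * u)%R)%E
    (fun u => G' (y + 1 * u)%R + G' (y + -1 * u)%R)%E); last 4 first.
  - by apply: emeasurable_funD; [exact: c1|exact: c1].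
  - by apply: emeasurable_funD; [exact: c2|exact: c2].
  - by move=> t; apply: adde_ge0.
  - by move=> t; apply: adde_ge0.
  rewrite (add2 (fun u => G (x + 1 * u)%R)) // (add2 (fun u => G' (y + 1 * u)%R)) //.
  rewrite (shift G x 1)// ?normr1// (shift G x (-1))// ?normrN ?normr1//.
  rewrite (shift G' y 1)// ?normr1// (shift G' y (-1))// ?normrN ?normr1//.
  have EG : (\int[mu]_u G u = \int[mu2]_p Phi p)%E by have Q := @fubini_tonelli1 _ _ _ _ R mu mu Phi mPhi Phi0;  symmetry; exact: Q.
  have EG' : (\int[mu]_u G' u = \int[mu2]_p Phi p)%E.
    by rewrite -EG; have Q := @fubini_tonelli _ _ _ _ R mu mu Phi mPhi Phi0; symmetry; exact: Q.
  rewrite EG EG'; have : (0 <= \int[mu2]_p Phi p)%E by apply: integral_ge0.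
  (* The integral may still be infinite here, and then both sides are [+oo]. *)
  move: (integral _ _ _) => [I _||//].
    by rewrite -!EFinD -EFinM; congr (_%:E); ring.
  by rewrite gt0_muley// lte_fin.
have low : ((r * k * (r / 2))%:E <= \int[mu]_u F u)%E.
  apply: (@le_trans _ _ (\int[mu]_(u in `[(r / 2)%R, r]) F u)%E); last first.
    exact: ge0_subset_integral.
  apply: (@le_trans _ _ (\int[mu]_(u in `[(r / 2)%R, r]) (cst (r * k)%:E u))%E).
    rewrite integral_cst//= lebesgue_measure_itv/= lte_fin ifT; last by lra.
    by rewrite -EFinD -EFinM lee_fin le_eqVlt; apply/orP; left; apply/eqP; field.
  apply: ge0_le_integral => //=.
  - by move=> u _; rewrite lee_fin mulr_ge0// ltW.
  - exact: measurable_funTS.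
rewrite FI in low.
rewrite -/k (_ : r ^+ 2 * k = 2 * (r * k * (r / 2))); last by field.
rewrite EFinM (_ : 8%:E = 2%:E * 4%:E)%E; last by rewrite -EFinM; congr (_%:E); ring.
by rewrite -muleA lee_wpmul2l// lee_fin.
Qed.

End square_estimate.

Section weighted.
Variables (R : realType) (alpha : R).
Local Notation C := R[i].
Local Notation mu := (@lebesgue_measure R).
Local Notation mu2 := (mu \x mu)%E.
Local Notation H := (@right_half_plane R).
Local Notation H2 := [set p : R * R | H (p.1 +i* p.2)].
Implicit Type f : C -> C.

Definition density f (p : R * R) := normc (f (p.1 +i* p.2)) ^+ 2 * p.1 `^ alpha.

Lemma density_ge0 f p : 0 <= density f p.
Proof. by rewrite mulr_ge0 ?sqr_ge0 ?powR_ge0. Qed.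

Lemma measurable_half_plane : measurable H2.
Proof.
apply: measurable_open_prod => p Hp; exists p.1 => // q q1 _.
by move: q1 Hp; rewrite /right_half_plane/= ltr_norml; lra.
Qed.

Lemma measurable_density f : holomorphic_on H f -> measurable_fun H2 (EFin \o density f).
Proof.
move=> hf; apply/measurable_EFinP; apply: measurable_funM.
  by apply: measurable_funX; exact: measurable_normc_holomorphic.
by apply: measurable_funTS; apply: (measurableT_comp (measurable_powR _)).
Qed.

(** This bounds the oscillation of the weight on a square that stays away from the imaginary axis.
    For negative [alpha] the inverse ratio is raised to the power [- alpha]. *)
Lemma powR_ratio (x p : R) : 0 < p -> x <= 2 * p -> p <= 2 * x ->
  x `^ alpha <= 2 `^ `|alpha| * p `^ alpha.
Proof.
move=> p0 xp px; have x0 : 0 < x by lra.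
have bnd (s b : R) : 0 <= b -> 0 < s -> s <= 2 -> s `^ b <= 2 `^ b.
  by move=> b0 s0 s2; rewrite ge0_ler_powR ?nnegrE// ltW.
have [a0|a0] := leP 0 alpha.
  rewrite ger0_norm//.
  have -> : x `^ alpha = (x / p) `^ alpha * p `^ alpha.
    by rewrite -powRM ?divr_ge0 ?ltW// divfK// gt_eqF.
  apply: ler_wpM2r; first exact: powR_ge0.
  by apply: bnd => //; [exact: divr_gt0|rewrite ler_pdivrMr].
rewrite ltr0_norm//.
have -> : x `^ alpha = (p / x) `^ (- alpha) * p `^ alpha.
  have -> : p `^ alpha = (p / x) `^ alpha * x `^ alpha.
    by rewrite -powRM ?divr_ge0 ?ltW// divfK// gt_eqF.
  by rewrite powRN mulKf// gt_eqF// powR_gt0// divr_gt0.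
apply: ler_wpM2r; first exact: powR_ge0.
by apply: bnd; [lra|exact: divr_gt0|rewrite ler_pdivrMr].
Qed.

(** Since [k <= 1 / 2], abscissae in the square lie between [x / 2] and [3 * x / 2], so the weight
    may be moved inside the integral at the cost of [2 ^ |alpha|]. *)
Lemma weighted_square_estimate f (x y k : R) : holomorphic_on H f ->
  0 < x -> 0 < k <= 2^-1 ->
  ((k ^+ 2 * x `^ (2 + alpha) * normc (f (x +i* y)) ^+ 2)%:E <=
   (8 * 2 `^ `|alpha|)%:E * \int[mu2]_(p in square x y (k * x)) (density f p)%:E)%E.
Proof.
move=> hf x0 /andP[k0 k2].
have rx : 0 < k * x < x by apply/andP; split; nra.
have := square_estimate y hf rx.
have sH := @square_half_plane _ x y _ (proj2 (andP rx)).
have mS := measurable_square x y (k * x).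
move=> /(lee_wpmul2l (_ : 0 <= (x `^ alpha)%:E)%E); rewrite lee_fin powR_ge0 => /(_ isT).
rewrite -EFinM muleCA -ge0_integralZl//; last 3 first.
- apply/measurable_EFinP/measurable_funX.
  exact: measurable_funS measurable_half_plane sH (measurable_normc_holomorphic hf).
- by move=> p _; rewrite lee_fin sqr_ge0.
- by rewrite lee_fin powR_ge0.
move=> le1.
have -> : k ^+ 2 * x `^ (2 + alpha) * normc (f (x +i* y)) ^+ 2 =
    x `^ alpha * ((k * x) ^+ 2 * normc (f (x +i* y)) ^+ 2).
  have x2 : x `^ 2 = x ^+ 2 by exact: (powR_mulrn 2 (ltW x0)).
  by rewrite powRD ?(gt_eqF x0) ?implybT// x2 exprMn; ring.
apply: (le_trans le1); rewrite EFinM -muleA; apply: lee_wpmul2l; first by rewrite lee_fin.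
have md : measurable_fun (square x y (k * x)) (EFin \o density f).
  exact: measurable_funS measurable_half_plane sH (measurable_density hf).
rewrite -ge0_integralZl//; [|by move=> p _; rewrite lee_fin density_ge0].
apply: ge0_le_integral => //.
- by move=> p _; rewrite -EFinM lee_fin mulr_ge0 ?powR_ge0 ?sqr_ge0.
- by apply: measurable_funeM; apply/measurable_EFinP/measurable_funX;
    exact: measurable_funS measurable_half_plane sH (measurable_normc_holomorphic hf).
- by apply: measurable_funeM.
move=> [a b] [/=]; rewrite !in_itv/= => /andP[a1 a2] _.
rewrite -!EFinM lee_fin /density/= [leLHS]mulrC [leRHS]mulrCA ler_wpM2l ?sqr_ge0//.
by apply: powR_ratio; nra.
Qed.

Definition sqnorm f := fine (bergman_sqnorm alpha f).

Lemma sqnormE f : (bergman_sqnorm alpha f < +oo)%E ->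
  (\int[mu2]_(p in H2) (density f p)%:E)%E = (sqnorm f)%:E.
Proof.
move=> foo; rewrite /sqnorm fineK// ge0_fin_numE//.
by apply: integral_ge0 => p _; rewrite lee_fin; exact: density_ge0.
Qed.

Lemma sqnorm_ge0 f : 0 <= sqnorm f.
Proof.
by apply: fine_ge0; apply: integral_ge0 => p _; rewrite lee_fin; exact: density_ge0.
Qed.

(** The gap condition makes the projections of the squares to the real axis disjoint, so their
    weighted integrals add up to at most the squared norm. *)
Lemma square_sum_estimate f (y k : R) (x : nat -> R) n : holomorphic_on H f ->
  (bergman_sqnorm alpha f < +oo)%E -> 0 < k <= 2^-1 -> (forall i, 0 < x i) ->
  (forall i j, (i < j)%N -> x j * (1 + k) < x i * (1 - k)) ->
  k ^+ 2 * \sum_(i < n) x i `^ (2 + alpha) * normc (f (x i +i* y)) ^+ 2 <=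
    8 * 2 `^ `|alpha| * sqnorm f.
Proof.
move=> hf foo kI x0 xx.
pose S i := square (x i) y (k * x i).
have mS i : measurable (S i) by exact: measurable_square.
have SH i : S i `<=` H2.
  by apply: square_half_plane; have := x0 i; move: kI => /andP[]; nra.
have tS : trivIset [set` iota 0 n] S.
  apply/trivIsetP => i j _ _; wlog ij : i j / (i < j)%N.
    by move=> W ij; move: (ij); rewrite neq_ltn => /orP[/W->//|/W]; rewrite setIC => ->//; rewrite eq_sym.
  move=> _; apply/seteqP; split=> // -[a b] [[/= + _] [/= + _]].
  by rewrite !in_itv/=; have := xx i j ij; lra.
have mU : measurable (\big[setU/set0]_(i <- iota 0 n) S i).
  by apply: bigsetU_measurable.
have UH : \big[setU/set0]_(i <- iota 0 n) S i `<=` H2.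
  by move=> p; rewrite -bigcup_seq => -[i _] /SH.
have md : measurable_fun H2 (EFin \o density f) by exact: measurable_density.
rewrite -lee_fin [leRHS]EFinM -(sqnormE foo).
apply: (@le_trans _ _ ((8 * 2 `^ `|alpha|)%:E * \int[mu2]_(p in \big[setU/set0]_(i <- iota 0 n) S i) (density f p)%:E)%E); last first.
  apply: lee_wpmul2l; first by rewrite lee_fin mulr_ge0// powR_ge0.
  apply: ge0_subset_integral => //; first exact: measurable_half_plane.
  by move=> p _; rewrite lee_fin density_ge0.
rewrite ge0_integral_bigsetU//; last 3 first.
- exact: iota_uniq.
- exact: measurable_funS measurable_half_plane UH md.
- by move=> p _; rewrite lee_fin density_ge0.
rewrite ge0_sume_distrr; last first.
  by move=> i _; apply: integral_ge0 => p _; rewrite lee_fin density_ge0.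
rewrite mulr_sumr -sumEFin -(big_mkord xpredT (fun i => (k ^+ 2 * (x i `^ (2 + alpha) * normc (f (x i +i* y)) ^+ 2))%:E)).
rewrite /index_iota subn0; apply: lee_sum => i _; rewrite mulrA.
exact: weighted_square_estimate.
Qed.

(** Point evaluations are bounded, by a single square with [k = 1 / 2]; the constant is
    [32 = 8 * 4]. *)
Lemma point_estimate f (x y : R) : holomorphic_on H f ->
  (bergman_sqnorm alpha f < +oo)%E -> 0 < x ->
  x `^ (2 + alpha) * normc (f (x +i* y)) ^+ 2 <= 32 * 2 `^ `|alpha| * sqnorm f.
Proof.
move=> hf foo x0.
have k0 : (0 : R) < 2^-1 <= (2^-1 : R) by apply/andP; split; lra.
have mS := measurable_square x y (2^-1 * x).
have SH : square x y (2^-1 * x) `<=` H2 by apply: square_half_plane; lra.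
have := @weighted_square_estimate f x y _ hf x0 k0.
have le2 : (\int[mu2]_(p in square x y (2^-1 * x)) (density f p)%:E <= (sqnorm f)%:E)%E.
  rewrite -(sqnormE foo); apply: ge0_subset_integral => //; first exact: measurable_half_plane.
    exact: measurable_density.
  by move=> p _; rewrite lee_fin density_ge0.
have K0 : (0 <= (8 * 2 `^ `|alpha|)%:E)%E by rewrite lee_fin mulr_ge0// powR_ge0.
move=> /le_trans/(_ (lee_wpmul2l K0 le2)); rewrite -EFinM lee_fin; lra.
Qed.

(** The maps [z -> c z + i d] preserve the half-plane, and substitution in each coordinate
    multiplies the squared norm by a constant. They serve to move a point where a function does not
    vanish onto a given ray. *)
Lemma bergman_pred_affine f (c d : R) : 0 < c -> f \in bergman_pred alpha ->
  (fun z => f (c%:C * z + (0 +i* d))) \in bergman_pred alpha.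
Proof.
move=> c0 /bergmanP[hf f0 foo].
have Hc z : H (c%:C * z + (0 +i* d)) <-> H z.
  case: z => a b; rewrite /right_half_plane/= mul0r subr0 addr0.
  by rewrite pmulr_rgt0.
apply/bergmanP; split.
- move=> z /Hc Hz; exact: (holomorphic_on_affine hf Hz).
- by move=> z Hz; apply: f0 => /Hc.
set g := fun z => _.
pose Psi := (EFin \o density f) \_ H2.
have mPsi : measurable_fun setT Psi.
  by apply/(measurable_restrictT _ measurable_half_plane); exact: measurable_density.
have Psi0 p : (0 <= Psi p)%E.
  by apply: erestrict_ge0 => q _; rewrite lee_fin density_ge0.
(* The factor compensates for the weight being evaluated at [c * p.1] instead of [p.1]. *)
pose Psig p := ((c `^ alpha)^-1%:E * Psi ((c * p.1 + 0)%R, (c * p.2 + d)%R))%E.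
have PsigE : bergman_sqnorm alpha g = (\int[mu2]_p Psig p)%E.
  rewrite /bergman_sqnorm integral_mkcond; apply: eq_integral => -[a b] _.
  rewrite /Psig /Psi !patchE/= !addr0.
  have hE : (c * a +i* (c * b + d)) = c%:C * (a +i* b) + (0 +i* d).
    by apply/eqP; rewrite eq_complex/=; apply/andP; split; apply/eqP; ring.
  have [aH|aH] := pselect (H (a +i* b)); last first.
    rewrite memNset// memNset ?mule0//= hE; by move/Hc.
  rewrite mem_set// mem_set/= ?hE; last exact/Hc.
  rewrite -EFinM /density/= hE /g; congr (_%:E).
  have a0 : 0 <= a by apply/ltW; exact: aH.
  rewrite powRM ?(ltW c0)// mulrCA; congr (_ * _).
  by rewrite mulKf// gt_eqF// powR_gt0.
have mPsig : measurable_fun setT Psig.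
  apply: measurable_funeM; apply: (measurableT_comp mPsi).
  by apply: measurable_fun_pair; apply: measurable_funD => //; apply: measurable_funM => //.
have Psig0 p : (0 <= Psig p)%E by rewrite mule_ge0// lee_fin invr_ge0 powR_ge0.
have cn : c != 0 by rewrite gt_eqF.
have mPsi1 a : measurable_fun setT (fun b => Psi (a, b)).
  by apply: (measurableT_comp mPsi); exact: measurable_pair1.
pose G a := (\int[mu]_b Psi (a, b))%E.
have mG : measurable_fun setT G by exact: measurable_fun_fubini_tonelli_F.
have G0 a : (0 <= G a)%E by apply: integral_ge0.
have inner a : (`|c|%:E * \int[mu]_b Psig (a, b) = (c `^ alpha)^-1%:E * G (c * a + 0)%R)%E.
  rewrite /Psig/= ge0_integralZl//; last 2 first.
  - by apply: (measurableT_comp (mPsi1 _)); apply: measurable_funD => //; apply: measurable_funM.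
  - by rewrite lee_fin invr_ge0 powR_ge0.
  by rewrite muleCA -(ge0_integral_affine d cn (mPsi1 _))//.
have e1 : (\int[mu2]_p Psig p = \int[mu]_a \int[mu]_b Psig (a, b))%E.
  by have Q := @fubini_tonelli1 _ _ _ _ R mu mu Psig mPsig Psig0; exact: Q.
have e2 : (\int[mu]_a G a = bergman_sqnorm alpha f)%E.
  have Q := @fubini_tonelli1 _ _ _ _ R mu mu Psi mPsi Psi0.
  transitivity (\int[mu2]_p Psi p)%E; first by symmetry; exact: Q.
  by rewrite /bergman_sqnorm [RHS]integral_mkcond.
have mGg : measurable_fun setT (fun a => \int[mu]_b Psig (a, b))%E.
  exact: (@measurable_fun_fubini_tonelli_F _ _ _ _ R mu Psig).
move: G mG G0 inner e2 => G mG G0 inner e2.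
have e3 : (`|c|%:E * \int[mu2]_p Psig p = (c `^ alpha)^-1%:E * \int[mu]_a G (c * a + 0)%R)%E.
  rewrite e1 -ge0_integralZl//; last by move=> a _; apply: integral_ge0.
  under eq_integral do rewrite inner.
  have Zl (h : R -> \bar R) (k : R) : measurable_fun setT h -> (forall t, 0 <= h t)%E -> 0 <= k ->
      (\int[mu]_t (k%:E * h t) = k%:E * \int[mu]_t h t)%E.
    by move=> *; rewrite ge0_integralZl.
  apply: (Zl (fun a => G (c * a + 0)%R)) => //.
  - by apply: (measurableT_comp mG); apply: measurable_funD => //; apply: measurable_funM.
  - by rewrite invr_ge0 powR_ge0.
have e4 := ge0_integral_affine 0 cn mG G0.
(* By [e4] an infinite value here would make the squared norm of [f] infinite. *)
have fin : (\int[mu]_a G (c * a + 0)%R < +oo)%E.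
  rewrite ltNge leye_eq; apply/negP => /eqP e5; move: foo.
  by rewrite -e2 e4 e5 gt0_muley ?ltxx// lte_fin normr_gt0.
rewrite PsigE ltNge leye_eq; apply/negP => /eqP e5; move: e3.
rewrite e5 gt0_muley ?lte_fin ?normr_gt0// => e6.
have : ((c `^ alpha)^-1%:E * \int[mu]_a G (c * a + 0)%R < +oo)%E.
  by apply: lte_mul_pinfty => //; rewrite lee_fin invr_ge0 powR_ge0.
by rewrite -e6 ltxx.
Qed.

End weighted.

(** * Bilateral sums *)

Section bilateral.
Variables (V : zmodType).

(** The sum over [- N <= n <= N]. Symmetric truncation makes [n -> - n] an exact symmetry and leaves
    only two boundary terms after a shift by one. *)
Definition bisum (N : nat) (D : int -> V) : V :=
  D 0 + \sum_(j < N) (D j.+1%:Z + D (- j.+1%:Z)).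

Lemma bisum0 D : bisum 0 D = D 0.
Proof. by rewrite /bisum big_ord0 addr0. Qed.

Lemma bisumS N D : bisum N.+1 D = bisum N D + (D N.+1%:Z + D (- N.+1%:Z)).
Proof. by rewrite /bisum big_ord_recr addrA. Qed.

Lemma bisum_opp N D : bisum N (fun n => D (- n)) = bisum N D.
Proof.
rewrite /bisum oppr0; congr (_ + _); apply: eq_bigr => j _.
by rewrite opprK addrC.
Qed.

Lemma bisumD N D E : bisum N (fun n => D n + E n) = bisum N D + bisum N E.
Proof.
rewrite /bisum addrACA -big_split; congr (_ + _); apply: eq_bigr => j _.
exact: addrACA.
Qed.

Lemma bisumN N D : bisum N (fun n => - D n) = - bisum N D.
Proof.
elim: N => [|N IH]; first by rewrite !bisum0.
by rewrite !bisumS IH !opprD.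
Qed.

End bilateral.

Section bilateral_num.
Variable R : realType.
Local Notation C := R[i].

Lemma bisum_shift N (D : int -> C) :
  bisum N (fun n => D (n + 1)) - bisum N D = D N.+1%:Z - D (- N%:Z).
Proof.
elim: N => [|N IH]; first by rewrite !bisum0 add0r oppr0.
rewrite !bisumS opprD addrACA IH.
rewrite (_ : N.+1%:Z + 1 = N.+2%:Z); last by lia.
rewrite (_ : - N.+1%:Z + 1 = - N%:Z); last by lia.
by ring.
Qed.

(** This enumeration lets a bilateral sum be estimated by [square_sum_estimate], whose points are
    indexed by naturals. *)
Lemma bisum_ord N (D : int -> R) : bisum N D = \sum_(i < N.*2.+1) D (i%:Z - N%:Z).
Proof.
elim: N => [|N IH]; first by rewrite bisum0 big_ord_recl big_ord0 addr0 subrr.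
rewrite bisumS IH doubleS [in RHS]big_ord_recr [in RHS]big_ord_recl /= sub0r.
rewrite (_ : (N.*2.+2)%:Z - N.+1%:Z = N.+1%:Z); last by lia.
rewrite [in RHS](eq_bigr (fun i : 'I_(N.*2.+1) => D (i%:Z - N%:Z))); last first.
  by move=> i _; congr D; rewrite /= /bump/=; lia.
by ring.
Qed.

Lemma le_bisum N (D E : int -> R) : (forall n, D n <= E n) -> bisum N D <= bisum N E.
Proof. by move=> DE; rewrite /bisum lerD// ler_sum// => j _; rewrite lerD. Qed.

Lemma bisumZ N (k : R) D : bisum N (fun n => k * D n) = k * bisum N D.
Proof.
elim: N => [|N IH]; first by rewrite !bisum0.
by rewrite !bisumS IH !mulrDr.
Qed.

Lemma bisumZc N (k : C) (D : int -> C) : bisum N (fun n => k * D n) = k * bisum N D.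
Proof.
elim: N => [|N IH]; first by rewrite !bisum0.
by rewrite !bisumS IH !mulrDr.
Qed.

Lemma normc_bisum N (D : int -> C) : normc (bisum N D) <= bisum N (fun n => normc (D n)).
Proof.
elim: N => [|N IH]; first by rewrite !bisum0.
rewrite !bisumS (le_trans (le_normcD _ _))// lerD// (le_trans (le_normcD _ _))//.
Qed.

Lemma bisum_geometric (q : R) N : 0 < q < 1 -> bisum N (fun n => q ^+ `|n|%N) <= 2 / (1 - q).
Proof.
move=> /andP[q0 q1]; have p0 : 0 < 1 - q by lra.
rewrite ler_pdivlMr//.
(* The slack [2 * q ^+ N.+1] is what passes through the induction on [N]. *)
suff : bisum N (fun n => q ^+ `|n|%N) * (1 - q) <= 2 - 2 * q ^+ N.+1.
  by have := exprn_gt0 N.+1 q0; lra.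
elim: N => [|N IH]; first by rewrite bisum0/= expr0 expr1; lra.
rewrite bisumS abszN/= mulrDl (le_trans (lerD IH (lexx _)))//.
by rewrite [q ^+ N.+2]exprS le_eqVlt; apply/orP; left; apply/eqP; ring.
Qed.

Definition vanishing (D : int -> C) := forall e, 0 < e ->
  exists N, forall n : int, (N <= `|n|)%N -> normc (D n) < e.

Lemma vanishing_shift D (m : int) : vanishing D -> vanishing (fun n => D (n + m)).
Proof.
move=> vD e /vD[N NP]; exists (N + `|m|)%N => n Nn; apply: NP; lia.
Qed.

Lemma bisum_vanishing (D : int -> C) (K : R) :
  (forall N, bisum N (fun n => normc (D n)) <= K) -> vanishing D.
Proof.
move=> DK e e0.
pose u (j : nat) := normc (D j.+1%:Z) + normc (D (- j.+1%:Z)).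
have u0 j : 0 <= u j by rewrite addr_ge0// normc_ge0.
have su : cvgn (series u).
  apply: nondecreasing_is_cvgn; first by apply: nondecreasing_series => j _ _.
  exists K => _ [n _ <-]; apply: le_trans (DK n).
  by rewrite /bisum /series/= big_mkord lerDr normc_ge0.
have /cvgrPdist_lt/(_ _ e0)[N _ NP] := cvg_series_cvg_0 su.
(* The term [u j] contains the indices [j + 1] and [- (j + 1)], hence the successor. *)
exists N.+1; case=> n Nn.
  case: n Nn => // n Nn; have := NP n Nn; rewrite /= sub0r normrN ger0_norm// /u.
  by have := normc_ge0 (D (- n.+1%:Z)); lra.
have := NP n Nn; rewrite /= sub0r normrN ger0_norm// /u NegzE.
by have := normc_ge0 (D n.+1%:Z); lra.
Qed.

Definition tends0 (s : nat -> C) := forall e, 0 < e ->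
  exists N, forall n : nat, (N <= n)%N -> normc (s n) < e.

Lemma tends0D s t : tends0 s -> tends0 t -> tends0 (fun n => s n + t n).
Proof.
move=> hs ht e e0; have e2 : 0 < e / 2 by lra.
have [N NP] := hs _ e2; have [M MP] := ht _ e2.
exists (maxn N M) => n; rewrite geq_max => /andP[/NP h1 /MP h2].
by rewrite (le_lt_trans (le_normcD _ _))//; lra.
Qed.

Lemma tends0Z k s : tends0 s -> tends0 (fun n => k * s n).
Proof.
move=> hs e e0; have k0 := normc_ge0 k.
have k1 : 0 < normc k + 1 by lra.
have [N NP] := hs _ (divr_gt0 e0 k1).
exists N => n /NP; rewrite normcM ltr_pdivlMr//; have := normc_ge0 (s n).
by nra.
Qed.

(** Each unit shift changes the truncated sum by two boundary terms, which tend to 0; the rest is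
    induction on [k]. *)
Lemma tends0_bisum_shift D (k : nat) : vanishing D ->
  tends0 (fun N => bisum N (fun n => D (n + k%:Z)) - bisum N D).
Proof.
move=> vD; elim: k => [|k IH].
  move=> e e0; exists 0%N => n _; under [in X in X - _]eq_fun do rewrite addr0.
  by rewrite subrr normc0.
have h : tends0 (fun N => bisum N (fun n => D (n + 1 + k%:Z)) - bisum N (fun n => D (n + k%:Z))).
  move=> e e0; have e2 : 0 < e / 2 by lra.
  have [N NP] := vanishing_shift k%:Z vD e2; exists N => n Nn.
  rewrite (bisum_shift n (fun n => D (n + k%:Z))) (le_lt_trans (le_normcD _ _))//.
  rewrite normcN (splitr e) ltrD// NP//; lia.
have := tends0D h IH; rewrite /tends0 => H e /H[N NP]; exists N => n /NP.
rewrite addrA subrK; congr (normc (bisum _ _ - _) < _).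
by apply/funext => m; congr D; rewrite -addrA -PoszD add1n.
Qed.

End bilateral_num.

(** * Bounded multipliers and the peak function *)

Lemma holomorphic_on_subr (K : numFieldType) (D : set K) (c : K) :
  holomorphic_on D (fun z => z - c).
Proof. by move=> z _; apply: derivableB; [exact: derivable_id|exact: derivable_cst]. Qed.

Lemma holomorphic_on_cst (K : numFieldType) (D : set K) (c : K) : holomorphic_on D (fun=> c).
Proof. by move=> z _; exact: derivable_cst. Qed.

Lemma holomorphic_onV (K : numFieldType) (D : set K) (f : K -> K) :
  holomorphic_on D f -> (forall z, D z -> f z != 0) -> holomorphic_on D (fun z => (f z)^-1).
Proof. by move=> hf f0 z Dz; apply: derivableV; [exact: f0|exact: hf]. Qed.

Section multiplier.
Variables (R : realType) (alpha : R).
Local Notation C := R[i].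
Local Notation mu := (@lebesgue_measure R).
Local Notation mu2 := (mu \x mu)%E.
Local Notation H := (@right_half_plane R).
Local Notation H2 := [set p : R * R | H (p.1 +i* p.2)].

Lemma bergman_pred_mul (f h : C -> C) (B : R) : f \in bergman_pred alpha ->
  holomorphic_on H h -> (forall z, H z -> normc (h z) <= B) ->
  (fun z => f z * h z) \in bergman_pred alpha.
Proof.
move=> /bergmanP[hf f0 foo] hh hB; apply/bergmanP; split.
- exact: holomorphic_onM.
- by move=> z Hz; rewrite f0// mul0r.
apply: (@le_lt_trans _ _ (\int[mu2]_(p in H2) ((B ^+ 2)%:E * (density alpha f p)%:E))%E).
  apply: ge0_le_integral => //.
  - exact: measurable_half_plane.
  - by move=> p _; rewrite lee_fin mulr_ge0 ?sqr_ge0 ?powR_ge0.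
  - exact: (measurable_density alpha (holomorphic_onM hf hh)).
  - by apply: measurable_funeM; exact: measurable_density.
  move=> p Hp; have hp := hB _ Hp; have n0 := normc_ge0 (h (p.1 +i* p.2)).
  rewrite -EFinM lee_fin /density normcM exprMn (mulrC (_ ^+ 2)) -mulrA.
  apply: ler_wpM2r; first by rewrite mulr_ge0 ?sqr_ge0 ?powR_ge0.
  by rewrite ler_sqr ?nnegrE//; exact: le_trans n0 hp.
rewrite ge0_integralZl//.
- by apply: lte_mul_pinfty => //; rewrite lee_fin sqr_ge0.
- exact: measurable_half_plane.
- exact: measurable_density.
- by move=> p _; rewrite lee_fin; exact: density_ge0.
- by rewrite lee_fin sqr_ge0.
Qed.

(** Minus the conjugate of [w]: the pole of the Blaschke factor of the half-plane with zero [w]. *)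
Definition reflection (w : C) : C := (- complex.Re w) +i* complex.Im w.

(* With B the Blaschke factor of the half-plane vanishing at w, this is
   1 - B ^+ 2: on the horizontal line through w its modulus is maximal only at w. *)
Definition peak (w z : C) : C := 1 - ((z - w) / (z - reflection w)) ^+ 2.

Lemma subr_reflection_neq0 (w z : C) : H w -> H z -> z - reflection w != 0.
Proof.
case: w z => [x y] [a b]; rewrite /right_half_plane /reflection/= => x0 a0.
by rewrite eq_complex/= negb_and gt_eqF//; lra.
Qed.

Lemma holomorphic_peak w : H w -> holomorphic_on H (peak w).
Proof.
move=> Hw.
have hQ : holomorphic_on H (fun z => (z - w) / (z - reflection w)).
  apply: holomorphic_onM; first exact: holomorphic_on_subr.
  by apply: holomorphic_onV; [exact: holomorphic_on_subr|move=> z; exact: subr_reflection_neq0].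
have -> : peak w = (fun z => 1 + (-1) * ((z - w) / (z - reflection w) * ((z - w) / (z - reflection w)))).
  by apply/funext => z; rewrite /peak expr2 mulN1r.
apply: holomorphic_onD; first exact: holomorphic_on_cst.
by apply: holomorphic_onZ; exact: holomorphic_onM.
Qed.

Lemma normc_peak w z : H w -> H z -> normc (peak w z) <= 2.
Proof.
move=> Hw Hz; have := subr_reflection_neq0 Hw Hz.
rewrite /peak => nz; rewrite (le_trans (le_normcD _ _))// normcN normc1 (_ : 2 = 1 + 1)// lerD2l.
rewrite expr2 normcM -expr2 exprn_ile1 ?normc_ge0// normcM normcV.
have n0 : 0 < normc (z - reflection w).
  by rewrite lt_def normc_ge0 andbT; apply: contra nz => /eqP/eq0_normc ->.
rewrite ler_pdivrMr// mul1r.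
(* Both [z] and [w] have positive real part, so [z] is at least as near to [w] as to its mirror
   image. *)
move: Hw Hz; rewrite /reflection /right_half_plane; case: w z {nz n0} => [x y] [a b] /= x0 a0.
by rewrite ler_wsqrtr//; nra.
Qed.

Lemma peak_ray (s x p e : R) : 0 <= s -> 0 < p -> 0 < x ->
  peak ((s + p) +i* e) ((s + x) +i* e) = (1 - ((x - p) / (2 * s + x + p)) ^+ 2)%:C.
Proof.
move=> s0 p0 x0; rewrite /peak /reflection/=.
rewrite (_ : ((s + x) +i* e) - ((s + p) +i* e) = (x - p)%:C); last first.
  by apply/eqP; rewrite eq_complex/=; apply/andP; split; apply/eqP; ring.
rewrite (_ : ((s + x) +i* e) - ((- (s + p)) +i* e) = (2 * s + x + p)%:C); last first.
  by apply/eqP; rewrite eq_complex/=; apply/andP; split; apply/eqP; ring.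
rewrite -fmorph_div; move: (_ / _) => r.
by apply/eqP; rewrite eq_complex/= !expr2/=; apply/andP; split; apply/eqP; ring.
Qed.

End multiplier.

(** * Boundedness of the pairing along a ray *)

Section pairing.
Variables (R : realType) (alpha a s e : R).
Hypotheses (halpha : -1 < alpha) (a0 : 0 < a) (a1 : a < 1) (s0 : 0 <= s).
Local Notation C := R[i].
Local Notation H := (@right_half_plane R).

Definition ray (x : R) : C := (s + x) +i* e.

Lemma ray_half_plane x : 0 < x -> H (ray x).
Proof. by rewrite /right_half_plane /ray/= => x0; rewrite ltr_wpDl. Qed.

(** The growth exponent: [x ^ beta * |f|] at a point of abscissa [x] is at most a constant times the
    norm of [f]. *)
Let beta := (2 + alpha) / 2.
Let beta0 : 0 < beta. Proof. by move: halpha; rewrite /beta; lra. Qed.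

Let powR_beta x : 0 <= x -> (x `^ beta) ^+ 2 = x `^ (2 + alpha).
Proof.
by move=> x0; rewrite -powR_mulrn ?powR_ge0// -powRrM /beta divfK// pnatr_eq0.
Qed.

Let am_gm (t u v : R) : 0 < t -> u * v <= t * u ^+ 2 + t^-1 * v ^+ 2.
Proof.
move=> t0; rewrite -(ler_pM2l t0) mulrDr [t * (t^-1 * _)]mulVKf ?gt_eqF//.
by have := sqr_ge0 (t * u - v); have := sqr_ge0 (t * u); have := sqr_ge0 v; nra.
Qed.

(** For [s = 0] the abscissae of the points form a geometric progression of ratio [a]. The choice
    [k = (1 - a) / 4] gives [a * (1 + k) < 1 - k], which makes the squares around them disjoint. *)
Let ray_sum (g : C -> C) P N : s = 0 -> 0 < P -> g \in bergman_pred alpha ->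
  bisum N (fun n => (a ^ n * P) `^ (2 + alpha) * normc (g (ray (a ^ n * P))) ^+ 2) <=
  8 * 2 `^ `|alpha| / ((1 - a) / 4) ^+ 2 * sqnorm alpha g.
Proof.
move=> s00 P0 /bergmanP[hg _ goo]; move: (a0) (a1) => a0' a1'.
pose k := (1 - a) / 4; have k0 : 0 < k <= 2^-1 by rewrite /k; apply/andP; split; lra.
have an0 n : 0 < a ^ n by exact: exprz_gt0.
(* The enumeration starts at the largest point [a ^ (- N) * P] and decreases. *)
pose x i := a ^+ i * (a ^ (- N%:Z) * P).
have x0 i : 0 < x i by rewrite mulr_gt0 ?exprn_gt0// mulr_gt0.
have xx i j : (i < j)%N -> x j * (1 + k) < x i * (1 - k).
  move=> ij; have xj : x j <= a * x i.
    rewrite /x mulrA -exprS ler_pM2r ?mulr_gt0//.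
    by apply: ler_wiXn2l => //; rewrite ltW.
  have k1 : 0 < 1 + k by rewrite /k; lra.
  have h : a * (1 + k) < 1 - k by rewrite /k; nra.
  rewrite (@le_lt_trans _ _ (a * x i * (1 + k)))//; first by rewrite ler_pM2r.
  by rewrite mulrAC mulrC ltr_pM2l// x0.
have := @square_sum_estimate _ _ g e k x N.*2.+1 hg goo k0 x0 xx.
rewrite bisum_ord -/k => h.
rewrite mulrAC ler_pdivlMr ?exprn_gt0//; last by case/andP: k0.
rewrite mulrC; apply: le_trans h; rewrite le_eqVlt; apply/orP; left; apply/eqP.
congr (_ * _); apply: eq_bigr => i _; rewrite /ray s00 add0r.
have -> // : a ^ (i%:Z - N%:Z) * P = x i.
by rewrite expfzDr ?gt_eqF// /x mulrA.
Qed.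

(** The free weight [t] plays the role of the Cauchy-Schwarz inequality: the term with [g] can be
    made small by a choice of [t] adapted to the norm of [g]. The constant is uniform in [N]. *)
Lemma pairing_bound (p p' : R) : 0 < p -> 0 < p' ->
  exists2 K, 0 <= K & forall f g : C -> C, f \in bergman_pred alpha -> g \in bergman_pred alpha ->
    forall t, 0 < t -> forall N,
    bisum N (fun n => normc (g (ray (a ^ n * p))) * normc (f (ray (a ^ (- n) * p')))) <=
    K * (t * sqnorm alpha g + t^-1 * sqnorm alpha f).
Proof.
move=> p0 p'0; have an0 n : 0 < a ^ n by exact: exprz_gt0.
have beta0' := beta0.
have [s00|] := eqVneq s 0.
  pose K1 := 8 * 2 `^ `|alpha| / ((1 - a) / 4) ^+ 2.
  (* For [s = 0] the product of [(a ^ n * p) ^ beta] and [(a ^ (- n) * p') ^ beta] is this constant,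
     independent of [n], so each term splits by [am_gm] into terms of two sums bounded by
     [ray_sum]. *)
  pose W := (p * p') `^ beta.
  have W0 : 0 < W by rewrite powR_gt0// mulr_gt0.
  have K10 : 0 <= K1 by rewrite divr_ge0 ?sqr_ge0// mulr_ge0// powR_ge0.
  exists (K1 / W); first by rewrite divr_ge0// ltW.
  move=> f g fA gA t t0 N.
  rewrite mulrAC ler_pdivlMr// mulrC -bisumZ.
  pose G n := (a ^ n * p) `^ (2 + alpha) * normc (g (ray (a ^ n * p))) ^+ 2.
  pose F n := (a ^ n * p') `^ (2 + alpha) * normc (f (ray (a ^ n * p'))) ^+ 2.
  have hG := ray_sum N s00 p0 gA; have hF := ray_sum N s00 p'0 fA.
  apply: (@le_trans _ _ (bisum N (fun n => t * G n + t^-1 * F (- n)))).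
    apply: le_bisum => n.
    have -> : W * (normc (g (ray (a ^ n * p))) * normc (f (ray (a ^ (- n) * p')))) =
       ((a ^ n * p) `^ beta * normc (g (ray (a ^ n * p)))) *
       ((a ^ (- n) * p') `^ beta * normc (f (ray (a ^ (- n) * p')))).
      rewrite mulrACA -powRM ?mulr_ge0 ?ltW//; congr (_ `^ _ * _).
      by rewrite mulrACA -expfzDr ?gt_eqF// subrr expr0z mul1r.
    apply: le_trans (am_gm _ _ t0) _.
    by rewrite /G /F !exprMn !powR_beta// mulr_ge0 ?ltW.
  rewrite bisumD !bisumZ bisum_opp.
  rewrite (_ : K1 * _ = t * (K1 * sqnorm alpha g) + t^-1 * (K1 * sqnorm alpha f)); last by ring.
  by rewrite lerD// ler_pM2l// invr_gt0.
move=> sn0; have sp : 0 < s by rewrite lt_def sn0.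
pose K2 := 32 * 2 `^ `|alpha|; have K20 : 0 <= K2 by rewrite mulr_ge0// powR_ge0.
pose m := Num.min p p'; have m0 : 0 < m by rewrite lt_min p0.
pose W := (s * m) `^ beta; have W0 : 0 < W by rewrite powR_gt0// mulr_gt0.
pose q := a `^ beta.
have q01 : 0 < q < 1.
  have b1 : 1 `^ beta = 1 :> R by rewrite powR1.
  rewrite powR_gt0//= -[X in _ < X]b1 gt0_ltr_powR ?nnegrE ?ltW//.
exists (K2 / W * (2 / (1 - q))).
  have /andP[? ?] := q01.
  by rewrite mulr_ge0 ?divr_ge0//; lra.
move=> f g fA gA t t0 N; pose Z := t * sqnorm alpha g + t^-1 * sqnorm alpha f; rewrite -/Z.
have Z0 : 0 <= Z.
  by apply: addr_ge0; apply: mulr_ge0; rewrite ?invr_ge0 ?sqnorm_ge0// ltW.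
apply: (@le_trans _ _ (bisum N (fun n => K2 / W * Z * q ^+ `|n|%N))); last first.
  rewrite bisumZ (_ : _ * Z = K2 / W * Z * (2 / (1 - q))); last by ring.
  by rewrite ler_wpM2l ?bisum_geometric// mulr_ge0// divr_ge0// ltW.
apply: le_bisum => n.
rewrite (_ : K2 / W * Z * _ = K2 * Z * q ^+ `|n|%N / W); last by ring.
rewrite ler_pdivlMr//.
set y := ray _; set y' := ray _.
pose X := s + a ^ n * p; pose X' := s + a ^ (- n) * p'.
have X0 : 0 < X by rewrite ltr_wpDl ?mulr_gt0.
have X'0 : 0 < X' by rewrite ltr_wpDl ?mulr_gt0.
(* One of [X], [X'] is at least [m / a ^+ |n|] and the other at least [s]; which is which depends on
   the sign of [n]. *)
have key : W <= (X * X') `^ beta * q ^+ `|n|%N.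
  have -> : q ^+ `|n|%N = (a ^+ `|n|%N) `^ beta.
    elim: (`|n|%N) => [|j IH]; first by rewrite !expr0 powR1.
    by rewrite !exprS IH powRM ?exprn_ge0// ltW.
  have XX0 : 0 <= X * X' by rewrite ltW// mulr_gt0.
  have aa0 : 0 <= a ^+ `|n|%N by rewrite ltW// exprn_gt0.
  have sm0 : 0 <= s * m by rewrite mulr_ge0// ltW.
  have XXa0 : 0 <= X * X' * a ^+ `|n|%N by rewrite mulr_ge0.
  rewrite -powRM// /W ge0_ler_powR ?nnegrE ?(ltW beta0')//.
  have m1 : m <= p by rewrite ge_min lexx.
  have m2 : m <= p' by rewrite ge_min lexx orbT.
  rewrite /X /X'; case: n {y y' X X' X0 X'0 XX0 aa0 sm0 XXa0} => n.
    rewrite -exprnN -exprnP [`|Posz n|%N]/=.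
    have h : a ^- n * p' * a ^+ n = p' by rewrite mulrAC mulVf ?mul1r// expf_neq0// gt_eqF.
    have h1 : 0 < a ^+ n by rewrite exprn_gt0.
    have h2 : 0 < a ^+ n * p by rewrite mulr_gt0.
    have h3 : 0 < a ^- n * p' by rewrite mulr_gt0// invr_gt0.
    move: h h1 h2 h3; move: (a ^- n * p') (a ^+ n) => A B h h1 h2 h3.
    rewrite -mulrA [_ * B]mulrDl h.
    have : 0 <= s * B by rewrite mulr_ge0// ltW.
    nra.
  rewrite NegzE opprK abszN -exprnN -exprnP [`|Posz n.+1|%N]/=.
  have h : a ^- n.+1 * p * a ^+ n.+1 = p by rewrite mulrAC mulVf ?mul1r// expf_neq0// gt_eqF.
  have h1 : 0 < a ^+ n.+1 by rewrite exprn_gt0.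
  have h2 : 0 < a ^+ n.+1 * p' by rewrite mulr_gt0.
  have h3 : 0 < a ^- n.+1 * p by rewrite mulr_gt0// invr_gt0.
  move: h h1 h2 h3; move: (a ^- n.+1 * p) (a ^+ n.+1) => A B h h1 h2 h3.
  rewrite (_ : _ * B = (s * B + p) * (s + B * p')); last by field; rewrite gt_eqF.
  have : 0 <= s * B by rewrite mulr_ge0// ltW.
  nra.
have est (h : C -> C) x : 0 < s + x -> h \in bergman_pred alpha ->
    ((s + x) `^ beta * normc (h (ray x))) ^+ 2 <= K2 * sqnorm alpha h.
  move=> x0 /bergmanP[hh _ hoo]; rewrite exprMn powR_beta ?(ltW x0)//.
  exact: (@point_estimate _ alpha h (s + x) e hh hoo x0).
have e1 := est g (a ^ n * p) X0 gA; have e2 := est f (a ^ (- n) * p') X'0 fA.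
apply: (@le_trans _ _ (normc (g y) * normc (f y') * ((X * X') `^ beta * q ^+ `|n|%N))).
  by rewrite ler_wpM2l// mulr_ge0// normc_ge0.
rewrite mulrA ler_wpM2r ?exprn_ge0 ?powR_ge0//.
rewrite (powRM beta (ltW X0) (ltW X'0)) (_ : normc (g y) * normc (f y') * _ = (X `^ beta * normc (g y)) * (X' `^ beta * normc (f y'))); last by ring.
apply: le_trans (am_gm _ _ t0) _.
rewrite /Z (_ : K2 * _ = t * (K2 * sqnorm alpha g) + t^-1 * (K2 * sqnorm alpha f)); last by ring.
by rewrite lerD// ler_pM2l ?invr_gt0.
Qed.

End pairing.

(** * Orbits along a ray *)

Lemma lin_span_ind (K : numFieldType) (X : normedModType K) (S : set X) (P : X -> Prop) :
  P 0 -> (forall u v, P u -> P v -> P (u + v)) -> (forall k u, P u -> P (k *: u)) ->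
  (forall u, S u -> P u) -> forall v, lin_span S v -> P v.
Proof.
move=> P0 PD PZ PS v [s sS [c ->]]; rewrite big_seq.
by apply: (big_ind P) => // u /sS/PS; exact: PZ.
Qed.

Section bergman_elements.
Variables (R : realType) (alpha : R).
Local Notation C := R[i].
Implicit Types u v : bergman alpha.

Lemma bergmanDE u v z : (u + v) z = u z + v z.
Proof. exact: (congr1 (fun h : C -> C => h z) (GRing.valD u v)). Qed.

Lemma bergmanBE u v z : (u - v) z = u z - v z.
Proof. by rewrite bergmanDE. Qed.

Lemma bergmanZE (k : C) u z : (k *: u) z = k * u z.
Proof. by []. Qed.

Lemma bergman0E z : (0 : bergman alpha) z = 0.
Proof. by []. Qed.

Lemma dense_approx (S : set (bergman alpha)) (g : bergman alpha) (d : R) :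
  dense S -> 0 < d -> exists2 v, S v & sqnorm alpha (g - v : bergman alpha) < d ^+ 2.
Proof.
move=> dS d0; have d0C : 0 < d%:C by rewrite ltcR.
pose O : set (bergman alpha) := interior (ball g d%:C).
have oO : open O by exact: open_interior.
have O0 : O !=set0 by exists g; exact: nbhsx_ballx.
have [v [/interior_subset gv Sv]] := dS O O0 oO.
exists v => //; move: gv; rewrite -ball_normE /= bergman_normrE ltcR.
rewrite -[fine _]/(sqnorm alpha (g - v : bergman alpha)) => lt.
rewrite -(sqr_sqrtr (sqnorm_ge0 alpha _)) ltr_sqr// ?nnegrE ?sqrtr_ge0//.
exact: ltW.
Qed.

End bergman_elements.

Section orbit.
Variables (R : realType) (alpha a s e : R) (b : R[i]).
Hypotheses (halpha : -1 < alpha) (a0 : 0 < a) (a1 : a < 1) (s0 : 0 <= s).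
Hypotheses (hs : a * s + complex.Re b = s) (he : a * e + complex.Im b = e).
Local Notation C := R[i].
Local Notation H := (@right_half_plane R).
Local Notation T := (@composition R alpha (fun w : R[i] => a%:C * w + b)).
Local Notation pt := (ray s e).

(* An iterate that leaves the space is replaced by 0, the default value in
   [composition], so the boundedness of the operator is not needed. *)
Lemma orbit_on_ray (f : bergman alpha) k :
  (forall x, 0 < x -> iter k T f (pt x) = 0) \/
  (forall x, 0 < x -> iter k T f (pt x) = f (pt (a ^+ k * x))).
Proof.
elim: k => [|k IH]; first by right=> x _; rewrite expr0 mul1r.
rewrite iterS; move: (iter k T f) IH => g IH.
pose g' (z : C) := if 0 < complex.Re z then g (a%:C * z + b) else 0.
have [g'P|g'P] := boolP (g' \in bergman_pred alpha); last first.
  by left=> x x0; rewrite /composition /insubd insubN//= bergman0E.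
have Tg x : 0 < x -> T g (pt x) = g (pt (a * x)).
  move=> x0; rewrite compositionE//; last exact: ray_half_plane.
  have -> : b = (s - a * s) +i* (e - a * e).
    move: hs he; case: b => b1 b2 /= h1 h2.
    by apply/eqP; rewrite eq_complex/=; apply/andP; split; apply/eqP;
      [rewrite -{1}h1|rewrite -{1}h2]; ring.
  congr (g _); rewrite /ray; apply/eqP; rewrite eq_complex/=.
  by apply/andP; split; apply/eqP; ring.
case: IH => IH; [left|right] => x x0; rewrite Tg// IH ?mulr_gt0//.
by rewrite exprSr mulrA.
Qed.

(** The truncation to [- N <= n <= N] of the functional L. Its antisymmetry in [p] and [p'] is what
    makes it annihilate the orbit of [f]. *)
Definition pairing (f : C -> C) (p p' : R) N (g : C -> C) : C :=
  bisum N (fun n => g (pt (a ^ n * p)) * f (pt (a ^ (- n) * p')) -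
                    g (pt (a ^ n * p')) * f (pt (a ^ (- n) * p))).

(** On an orbit element the two halves are shifts of one bilateral sum, so their difference tends to
    0. Linearity extends this to the span, and the bound uniform in [N] extends it to the
    closure. *)
Lemma pairing_vanishes (f : bergman alpha) (p p' : R) : 0 < p -> 0 < p' ->
  dense (lin_span [set iter n T f | n in [set: nat]]) ->
  forall g : bergman alpha, tends0 (fun N => pairing f p p' N g).
Proof.
move=> p0 p'0 dT.
have an0 n : 0 < a ^ n by exact: exprz_gt0.
have [K1 K10 K1P] := pairing_bound e halpha a0 a1 s0 p0 p'0.
have [K2 K20 K2P] := pairing_bound e halpha a0 a1 s0 p'0 p0.
have fP := bergman_funP f.
have LD u v N : pairing f p p' N (u + v : bergman alpha) = pairing f p p' N u + pairing f p p' N v.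
  by rewrite /pairing -bisumD; congr bisum; apply/funext => n; rewrite !bergmanDE; ring.
have LZ k u N : pairing f p p' N (k *: u : bergman alpha) = k * pairing f p p' N u.
  by rewrite /pairing -bisumZc; congr bisum; apply/funext => n; rewrite !bergmanZE; ring.
have zero (D : nat -> C) : (forall N, D N = 0) -> tends0 D.
  by move=> D0 d d0; exists 0%N => N _; rewrite D0 normc0.
have bisum_eq0 N (D : int -> C) : (forall n, D n = 0) -> bisum N D = 0.
  move=> D0; rewrite /bisum D0 add0r big1// => j _.
  by rewrite !D0 addr0.
have Lspan v : lin_span [set iter n T f | n in [set: nat]] v ->
    tends0 (fun N => pairing f p p' N v).
  move: v; apply: (@lin_span_ind _ _ _ (fun v : bergman alpha => tends0 (fun N => pairing f p p' N v))).
  - by apply: zero => N; apply: bisum_eq0 => n; rewrite !bergman0E; ring.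
  - move=> u v hu hv; under [X in tends0 X]eq_fun do rewrite LD.
    exact: tends0D.
  - by move=> k u hu; under [X in tends0 X]eq_fun do rewrite LZ; exact: tends0Z.
  move=> _ [k _ <-].
  case: (orbit_on_ray f k) => uE.
    by apply: zero => N; apply: bisum_eq0 => n; rewrite !uE ?mulr_gt0//; ring.
  have uP := bergman_funP (iter k T f); move: (iter k T f) uE uP => u uE uP.
  pose D n := u (pt (a ^ n * p)) * f (pt (a ^ (- n) * p')).
  have vD : vanishing D.
    apply: (@bisum_vanishing _ _ (K1 * (1 * sqnorm alpha u + 1^-1 * sqnorm alpha f))) => N.
    apply: le_trans (K1P f u fP uP 1 ltr01 N).
    by apply: le_bisum => n; rewrite /D normcM.
  have ak n x : a ^+ k * (a ^ n * x) = a ^ (n + k%:Z) * x.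
    by rewrite mulrA expfzDr ?gt_eqF// [a ^ n * _]mulrC.
  (* The first half of the pairing is the sum of [Dt (m + k)], the second that of [Dt (- m)], hence
     of [Dt m] by symmetry. *)
  pose Dt n := D (n - k%:Z).
  have vDt : vanishing Dt by exact: (vanishing_shift (- k%:Z) vD).
  have := tends0_bisum_shift k vDt; rewrite /tends0 => h d d0.
  have [N NP] := h d d0; exists N => n /NP.
  congr (normc _ < d).
  rewrite -(bisum_opp _ Dt) -bisumN -bisumD /pairing; congr bisum; apply/funext => m.
  rewrite /Dt addrK /D; congr (_ - _).
  rewrite !uE ?mulr_gt0// !ak subrK mulrC (_ : - (- m - k%:Z) = m + k%:Z)//.
  by rewrite opprD !opprK.
move=> g d d0; have sf0 := sqnorm_ge0 alpha f.
pose K := K1 + K2; have K0 : 0 <= K by rewrite addr_ge0.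
have M0 : 0 < 2 * (K + 1) * (1 + sqnorm alpha f) by rewrite !mulr_gt0//; lra.
(* With [sqnorm (g - v) < r ^+ 2] and weight [r^-1], the pairing of [g - v] is at most
   [K * r * (1 + sqnorm f)], which this choice keeps below [d / 2]. *)
pose r := d / (2 * (K + 1) * (1 + sqnorm alpha f)).
have r0 : 0 < r by rewrite divr_gt0.
have [v vS gv] := dense_approx g dT r0.
have d2 : 0 < d / 2 by lra.
have [N NP] := Lspan v vS _ d2; exists N => n /NP vn.
rewrite -[g](subrK v) LD (le_lt_trans (le_normcD _ _))// (splitr d) ler_ltD//.
have ri0 : 0 < r^-1 by rewrite invr_gt0.
have wP := bergman_funP (g - v); move: (g - v) gv wP => w wr wP.
have le1 : normc (pairing f p p' n w) <= K * (r^-1 * sqnorm alpha w + r^-1^-1 * sqnorm alpha f).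
  rewrite /pairing bisumD bisumN (le_trans (le_normcD _ _))// normcN /K mulrDl lerD//.
    apply: le_trans (K1P f w fP wP _ ri0 n); apply: le_trans (normc_bisum _ _) _.
    by apply: le_bisum => m; rewrite normcM.
  apply: le_trans (K2P f w fP wP _ ri0 n); apply: le_trans (normc_bisum _ _) _.
  by apply: le_bisum => m; rewrite normcM.
apply: (le_trans le1); rewrite invrK.
apply: (@le_trans _ _ (K * (r * (1 + sqnorm alpha f)))).
  rewrite ler_wpM2l// mulrDr mulr1 lerD2r mulrC ler_pdivrMr// -expr2.
  exact: ltW.
have rE : 2 * (K + 1) * (r * (1 + sqnorm alpha f)) = d.
  by rewrite /r; field; rewrite !gt_eqF//; lra.
have : 0 <= r * (1 + sqnorm alpha f) by rewrite mulr_ge0 ?(ltW r0)//; lra.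
move: rE; move: (r * (1 + _)) => y rE y0; nra.
Qed.

End orbit.

(** * Vanishing of a cyclic vector on the ray *)

(** The ratio increases with [x] and is zero at [p], so outside []u, v[] its modulus is at least the
    smaller of its moduli at [u] and [v]. Thus [peak] based at [p] is bounded by [q < 1] on the ray
    away from [p]. *)
Lemma reflection_ratio_gap (R : realType) (s p u v : R) : 0 <= s -> 0 < u -> u < p -> p < v ->
  exists2 q, 0 <= q < 1 & forall x, 0 < x -> x <= u \/ v <= x ->
    0 <= 1 - ((x - p) / (2 * s + x + p)) ^+ 2 <= q.
Proof.
move=> s0 u0 up pv.
pose c1 := (p - u) / (2 * s + u + p); pose c2 := (v - p) / (2 * s + v + p).
have c10 : 0 < c1 by rewrite divr_gt0//; lra.
have c20 : 0 < c2 by rewrite divr_gt0//; lra.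
have c11 : c1 <= 1 by rewrite ler_pdivrMr; lra.
pose c := Num.min c1 c2.
have c0 : 0 < c by rewrite lt_min c10.
have cc1 : c <= c1 by rewrite ge_min lexx.
have cc2 : c <= c2 by rewrite ge_min lexx orbT.
exists (1 - c ^+ 2).
  have : c <= 1 by exact: le_trans cc1 c11.
  by move: c0; clear; move: (c) => k k0 k1; apply/andP; split; nra.
move=> x x0 xx; have d0 : 0 < 2 * s + x + p by lra.
have r1 : `|(x - p) / (2 * s + x + p)| <= 1.
  rewrite normrM normfV (gtr0_norm d0) ler_pdivrMr// mul1r ler_norml; lra.
have rc : c <= `|(x - p) / (2 * s + x + p)|.
  rewrite normrM normfV (gtr0_norm d0).
  case: xx => xx.
    apply: (le_trans cc1); rewrite ltr0_norm; last by lra.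
    rewrite /c1 ler_pdivrMr; last by lra.
    rewrite mulrAC ler_pdivlMr//; nra.
  apply: (le_trans cc2); rewrite gtr0_norm; last by lra.
  rewrite /c2 ler_pdivrMr; last by lra.
  rewrite mulrAC ler_pdivlMr//; nra.
rewrite -(real_normK (num_real ((x - p) / _))).
move: c0 r1 rc; clear; move: `|_| (c) => r k k0 r1 rc.
by apply/andP; split; nra.
Qed.

Section vanish.
Variables (R : realType) (alpha a s e : R) (b : R[i]).
Hypotheses (halpha : -1 < alpha) (a0 : 0 < a) (a1 : a < 1) (s0 : 0 <= s).
Hypotheses (hs : a * s + complex.Re b = s) (he : a * e + complex.Im b = e).
Local Notation C := R[i].
Local Notation H := (@right_half_plane R).
Local Notation T := (@composition R alpha (fun w : R[i] => a%:C * w + b)).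
Local Notation pt := (ray s e).
Variable f : bergman alpha.
Hypothesis dT : dense (lin_span [set iter n T f | n in [set: nat]]).

(** The interval []p', p' / a[] contains [p], but no [a ^ n * p'] and no other [a ^ n * p], because
    consecutive points of either sequence have ratio [a]. *)
Lemma orbit_gap (n : int) (p p' : R) : 0 < p' -> a * p < p' -> p' < p ->
  (n = 0 \/ a ^ n * p <= p' \/ p' / a <= a ^ n * p) /\
  (a ^ n * p' <= p' \/ p' / a <= a ^ n * p').
Proof.
move=> p'0 ap pp; have [a0' a1'] := (a0, a1).
have ak k : 0 < a ^+ k <= 1 by rewrite exprn_gt0//= exprn_ile1 ?ltW.
have neg k y : 0 < y -> y / a <= a ^ (Negz k) * y.
  move=> y0; rewrite NegzE -exprnN mulrC ler_pM2r// exprS invfM.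
  have /andP[h1 h2] := ak k; rewrite ler_peMr ?invr_ge0 ?(ltW a0')//.
  by rewrite invf_ge1.
case: n => n.
  have /andP[h1 h2] := ak n; rewrite -exprnP; split; last by left; nra.
  case: n h1 h2 => [|n] h1 h2; [by left|right; left].
  have /andP[h3 h4] := ak n; rewrite exprS; apply: ltW; apply: le_lt_trans ap.
  by rewrite mulrAC ler_piMr// mulr_ge0 ?(ltW a0')//; lra.
split; last by right; exact: neg.
right; right; apply: le_trans (neg n p _); last by lra.
by rewrite ler_pM2r ?invr_gt0// ltW.
Qed.

Lemma orbit_pair_eq0 (p p' : R) : 0 < p' -> a * p < p' -> p' < p ->
  f (pt p) * f (pt p') = 0.
Proof.
move=> p'0 ap pp; have p0 : 0 < p by exact: lt_trans pp.
have an0 n : 0 < a ^ n by exact: exprz_gt0.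
have fP := bergman_funP f.
have pa : p < p' / a by rewrite ltr_pdivlMr// mulrC.
have [q /andP[q0 q1] qP] := reflection_ratio_gap s0 p'0 pp pa.
have [K1 K10 K1P] := pairing_bound e halpha a0 a1 s0 p0 p'0.
have [K2 K20 K2P] := pairing_bound e halpha a0 a1 s0 p'0 p0.
pose h := peak (pt p).
have Hw : H (pt p) by exact: ray_half_plane.
have hray x : 0 < x -> h (pt x) = (1 - ((x - p) / (2 * s + x + p)) ^+ 2)%:C.
  by move=> x0; exact: peak_ray.
have hn x : 0 < x -> x <= p' \/ p' / a <= x -> normc (h (pt x)) <= q.
  move=> x0 xx; rewrite hray//; have /andP[y0 yq] := qP x x0 xx.
  by move: y0 yq; move: (1 - _) => y y0 yq; rewrite /= expr0n addr0 sqrtr_sqr ger0_norm.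
(* In the pairing of [G m], the factor [h ^+ m] equals 1 in the first half at [n = 0] and is at most
   [q ^+ m] everywhere else. *)
pose G m z := f z * h z ^+ m.
have GP m : G m \in bergman_pred alpha.
  elim: m => [|m IH].
    rewrite (_ : G 0%N = f)//; apply/funext => z; by rewrite /G expr0 mulr1.
  rewrite (_ : G m.+1 = (fun z => G m z * h z)).
    apply: (bergman_pred_mul IH (holomorphic_peak Hw)) => z Hz; exact: normc_peak.
  by apply/funext => z; rewrite /G exprSr mulrA.
set D0 := f (pt p) * f (pt p').
pose K := K1 * (1 * sqnorm alpha f + 1^-1 * sqnorm alpha f) +
          K2 * (1 * sqnorm alpha f + 1^-1 * sqnorm alpha f).
have bound m : normc D0 <= q ^+ m * K.
  rewrite leNgt; apply/negP => lt.
  have := pairing_vanishes halpha a0 a1 s0 hs he p0 p'0 dT (Bergman (GP m)).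
  move=> /(_ (normc D0 - q ^+ m * K)); rewrite subr_gt0 => /(_ lt)[N /(_ N (leqnn N))].
  (* The general term of the pairing with the surviving term [D0] removed at [n = 0]. *)
  pose E n := G m (pt (a ^ n * p)) * f (pt (a ^ (- n) * p')) -
    G m (pt (a ^ n * p')) * f (pt (a ^ (- n) * p)) - (if n == 0 then D0 else 0).
  have En n : normc (E n) <= q ^+ m * (normc (f (pt (a ^ n * p))) * normc (f (pt (a ^ (- n) * p'))) +
      normc (f (pt (a ^ n * p'))) * normc (f (pt (a ^ (- n) * p)))).
    have [h1 h2] := orbit_gap n p'0 ap pp.
    have hm x : 0 < x -> x <= p' \/ p' / a <= x -> normc (h (pt x) ^+ m) <= q ^+ m.
      move=> x0 xx; have := hn x x0 xx; elim: m {E GP lt} => [|m IH] hq; first by rewrite !expr0 normc1.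
      by rewrite !exprS normcM ler_pM ?normc_ge0// IH.
    have e2 : normc (G m (pt (a ^ n * p')) * f (pt (a ^ (- n) * p))) <=
       q ^+ m * (normc (f (pt (a ^ n * p'))) * normc (f (pt (a ^ (- n) * p)))).
      rewrite /G !normcM mulrAC mulrC ler_wpM2r ?hm ?mulr_gt0//.
      by rewrite mulr_ge0 ?normc_ge0.
    rewrite /E mulrDr.
    (* At [n = 0] the first product is exactly [D0] and cancels, so only the second one has to be
       estimated. *)
    have [n0|n0] := eqVneq n 0.
      rewrite n0 oppr0 !expr0z !mul1r (_ : G m (pt p) * f (pt p') = D0).
        rewrite addrAC subrr add0r normcN.
        move: e2; rewrite n0 oppr0 !expr0z !mul1r => e2.
        apply: (le_trans e2); rewrite lerDr mulr_ge0 ?exprn_ge0// mulr_ge0 ?normc_ge0//.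
      by rewrite /G hray// subrr mul0r expr0n subr0 expr1n mulr1.
    rewrite subr0 (le_trans (le_normcD _ _))// normcN lerD// /G !normcM mulrAC mulrC.
    rewrite ler_wpM2r ?mulr_ge0 ?normc_ge0// hm ?mulr_gt0//.
    by case: h1 n0 => [->|//]; rewrite eqxx.
  have bD0 : bisum N (fun n : int => if n == 0 then D0 else 0) = D0.
    by rewrite /bisum eqxx big1 ?addr0// => j _; rewrite addr0.
  have -> : pairing a s e f p p' N (Bergman (GP m)) = bisum N E + D0.
    by rewrite -[X in _ + X]bD0 -bisumD; congr bisum; apply/funext => n; rewrite /E subrK.
  have le1 : normc (bisum N E) <= q ^+ m * K.
    apply: (le_trans (normc_bisum _ _)); apply: (le_trans (le_bisum N En)).
    rewrite bisumZ ler_wpM2l ?exprn_ge0// bisumD lerD//.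
      exact: (K1P f f fP fP 1 ltr01 N).
    exact: (K2P f f fP fP 1 ltr01 N).
  have := le_normcD (bisum N E + D0) (- bisum N E).
  by rewrite addrAC subrr add0r normcN; lra.
have [//|D0n] := eqVneq D0 0.
have D00 : 0 < normc D0.
  by rewrite lt_def normc_ge0 andbT; apply: contra D0n => /eqP/eq0_normc ->.
have K0 : 0 <= K.
  by rewrite addr_ge0// mulr_ge0// addr_ge0// mulr_ge0 ?sqnorm_ge0// invr_ge0.
have q1' : `|q| < 1 by rewrite ger0_norm.
have K1' : 0 < K + 1 by lra.
have /cvgrPdist_lt/(_ _ (divr_gt0 D00 K1'))[M _ /(_ M (leqnn M))] := cvg_expr q1'.
rewrite /= sub0r normrN ger0_norm ?exprn_ge0// ltr_pdivlMr// => lt.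
move: lt; rewrite ltNge => /negP; case; apply: le_trans (bound M) _.
by rewrite ler_wpM2l ?exprn_ge0// lerDl.
Qed.

(** If [f] were nonzero at the point of parameter [p], it would be nonzero by continuity at a nearby
    [p' < p], and the product of the two values would not vanish. *)
Lemma orbit_ray_eq0 (p : R) : 0 < p -> f (pt p) = 0.
Proof.
move=> p0; apply/eqP; apply/negPn/negP => fp.
have [hf _ _] := bergmanP _ _ (bergman_funP f).
have n0 : 0 < normc (f (pt p)).
  by rewrite lt_def normc_ge0 andbT; apply: contra fp => /eqP/eq0_normc ->.
have [d d0 dP] := @holomorphic_near R f (s + p, e) _ hf (ray_half_plane e s0 p0) n0.
have [a0' a1'] := (a0, a1).
(* The first entry keeps [p'] within [d] of [p], the second, the midpoint of [a * p] and [p], keeps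
   it above [a * p]. *)
pose p' := Num.max (p - d / 2) ((a * p + p) / 2).
have pp : p' < p by rewrite gt_max; apply/andP; split; nra.
have ap : a * p < p' by rewrite lt_max; apply/orP; right; nra.
have p'0 : 0 < p' by apply: lt_trans ap; rewrite mulr_gt0.
have pd : p - d / 2 <= p' by rewrite le_max lexx.
have := orbit_pair_eq0 p'0 ap pp => /eqP; rewrite mulf_eq0 (negbTE fp)/= => /eqP fp'.
have [||_] := dP (s + p', e).
- by rewrite /= ltr_norml; apply/andP; split; lra.
- by rewrite /= subrr normr0.
by rewrite -/(ray s e p) -/(ray s e p') fp' subr0 ltxx.
Qed.

End vanish.

Theorem proposition11 (R : realType) (alpha a : R) (b : R[i])
  (halpha : -1 < alpha) (ha_gt0 : 0 < a) (ha_lt1 : a < 1)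
  (hb : 0 <= complex.Re b) :
  ~ cyclic (@composition R alpha (fun w : R[i] => a%:C * w + b)).
Proof.
case=> f [f0 dT].
have a1 : 0 < 1 - a by lra.
(* The fixed point [b / (1 - a)] in coordinates. *)
pose s := complex.Re b / (1 - a); pose e := complex.Im b / (1 - a).
have s0 : 0 <= s by rewrite divr_ge0// ltW.
have hs : a * s + complex.Re b = s by rewrite /s; field; rewrite gt_eqF.
have he : a * e + complex.Im b = e by rewrite /e; field; rewrite gt_eqF.
have fray := orbit_ray_eq0 halpha ha_gt0 ha_lt1 s0 hs he dT.
have [hf fH _] := bergmanP _ _ (bergman_funP f).
have [z fz] : exists z, f z != 0.
  apply: contrapT => nz; move/eqP: f0; apply; apply: val_inj; apply/funext => z.
  by apply: contrapT => /eqP fz; apply: nz; exists z.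
have zH : 0 < complex.Re z.
  by apply: contrapT => nH; move/eqP: fz; apply; exact: fH.
(* The automorphism [w -> c w + i d] carries [ray s e 1] to [z], so [g] does not vanish at
   [ray s e 1], whereas every element of the span does. *)
pose c := complex.Re z / (s + 1); pose d := complex.Im z - c * e.
have s1 : 0 < s + 1 by lra.
have c0 : 0 < c by rewrite divr_gt0.
pose g : bergman alpha := Bergman (bergman_pred_affine d c0 (bergman_funP f)).
have gE : g (ray s e 1) = f z.
  rewrite /g/=; congr (f _).
  rewrite [RHS](_ : z = complex.Re z +i* complex.Im z); last by case: (z).
  apply/eqP; rewrite eq_complex/=; apply/andP; split; apply/eqP.
    by rewrite /c/=; field; rewrite gt_eqF.
  by rewrite /d/=; ring.
have spanz v : lin_span [set iter n (@composition R alpha (fun w : R[i] => a%:C * w + b)) f | n in [set: nat]] v ->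
    v (ray s e 1) = 0.
  move: v; apply: (@lin_span_ind _ _ _ (fun v : bergman alpha => v (ray s e 1) = 0)).
  - exact: bergman0E.
  - by move=> u v hu hv; rewrite bergmanDE hu hv addr0.
  - by move=> k u hu; rewrite bergmanZE hu mulr0.
  move=> _ [k _ <-]; have [h|h] := orbit_on_ray ha_gt0 s0 hs he f k; rewrite h//.
  by apply: fray; rewrite mulr_gt0// exprn_gt0.
pose X := (s + 1) `^ (2 + alpha) * normc (f z) ^+ 2.
have n0 : 0 < normc (f z).
  by rewrite lt_def normc_ge0 andbT; apply: contra fz => /eqP/eq0_normc ->.
have X0 : 0 < X by rewrite mulr_gt0 ?powR_gt0// exprn_gt0.
pose K := 32 * 2 `^ `|alpha|.
have K0 : 0 < K by rewrite mulr_gt0// powR_gt0.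
(* The point estimate at [ray s e 1] gives [X <= K * sqnorm (g - v)], so no [v] in the span comes
   within this distance of [g]. *)
have r0 : 0 < Num.sqrt (X / K) by rewrite sqrtr_gt0 divr_gt0.
have [v vS] := dense_approx g dT r0.
rewrite sqr_sqrtr ?(ltW (divr_gt0 X0 K0))// ltr_pdivlMr// ltNge => /negP; apply.
have [hw _ wo] := bergmanP _ _ (bergman_funP (g - v)).
have := point_estimate e hw wo s1.
by rewrite -/(ray s e 1) bergmanBE gE (spanz v vS) subr0 -/X -/K mulrC.
Qed.
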